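(* Let $\mathcal{S}$ be a properly immersed minimal surface in $\mathrm{Sol}_3$. If $\mathcal{S}$ lies on one side of some special plane $\mathcal{E}^t$ ($t\in\mathbb{R}$), then $\mathcal{S}$ is the special plane $\mathcal{E}^u$ for some $u\in\mathbb{R}$.
   Context: $\mathrm{Sol}_3$ is $\mathbb{R}^3$ with coordinates $(x_1,x_2,s)$ endowed with the Riemannian metric $$e^{2s}\,dx_1^2+e^{-2s}\,dx_2^2+ds^2.$$ For $t\in\mathbb{R}$, the special plane $\mathcal{E}^t$ is the surface $\{(x_1,x_2,s)\in\mathrm{Sol}_3 : s=t\}$. A minimal surface is a surface with vanishing mean curvature. A properly immersed minimal surface is the image of a proper minimal immersion of a (non-empty) connected surface without boundary. ''$\mathcal{S}$ lies on one side of $\mathcal{E}^t$'' means that $\mathcal{S}$ is contained in the closure of one of the two connected components of $\mathrm{Sol}_3\setminus\mathcal{E}^t$, i.e. $s\geq t$ on all of $\mathcal{S}$ or $s\leq t$ on all of $\mathcal{S}$. *)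

(* Defs.v *)
From HB Require Import structures.
From mathcomp Require Export all_boot all_order all_algebra.
From mathcomp Require Export all_classical all_reals all_analysis.

Set Implicit Arguments.
Unset Strict Implicit.
Unset Printing Implicit Defensive.

Import Order.TTheory GRing.Theory Num.Theory.
Import numFieldNormedType.Exports.

Local Open Scope classical_set_scope.
Local Open Scope ring_scope.

Definition partial (R : realType) (m n : nat) (i : 'I_m)
    (F : 'rV[R]_m -> 'rV[R]_n) : 'rV[R]_m -> 'rV[R]_n :=
  'D_(delta_mx 0 i) F.

(* Only meaningful for open U. *)
Fixpoint Ck_on (R : realType) (m n k : nat) (U : set 'rV[R]_m)
    (F : 'rV[R]_m -> 'rV[R]_n) : Prop :=
  if k is k'.+1 then
    (forall x, U x -> differentiable F x) /\
    (forall i, Ck_on k' U (partial i F))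
  else forall x, U x -> {for x, continuous F}.

Definition smooth_on (R : realType) (m n : nat) (U : set 'rV[R]_m)
    (F : 'rV[R]_m -> 'rV[R]_n) : Prop :=
  forall k, Ck_on k U F.

Record chart (R : realType) (M : topologicalType) := Chart {
  chart_dom : set M;
  chart_map : M -> 'rV[R]_2;
  chart_inv : 'rV[R]_2 -> M;
  chart_dom_open : open chart_dom;
  chart_img_open : open (chart_map @` chart_dom);
  chart_mapK : forall x, chart_dom x -> chart_inv (chart_map x) = x;
  chart_map_cont : {within chart_dom, continuous chart_map};
  chart_inv_cont : {within chart_map @` chart_dom, continuous chart_inv}
}.

Definition chart_img (R : realType) (M : topologicalType) (c : chart R M) :
  set 'rV[R]_2 := chart_map c @` chart_dom c.

(* An atlas asks for this for (c, d) and (d, c), so both transition maps are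
   smooth. *)
Definition smooth_transition (R : realType) (M : topologicalType)
    (c d : chart R M) : Prop :=
  smooth_on (chart_map c @` (chart_dom c `&` chart_dom d))
    (chart_map d \o chart_inv c).

Record surface (R : realType) := Surface {
  surface_carrier :> topologicalType;
  atlas : set (chart R surface_carrier);
  surface_hausdorff : hausdorff_space surface_carrier;
  surface_second_countable : @second_countable surface_carrier;
  atlas_cover : forall x, exists2 c, atlas c & chart_dom c x;
  atlas_compat : forall c d, atlas c -> atlas d -> smooth_transition c d
}.

Definition smooth_map (R : realType) (n : nat) (M : surface R)
    (f : M -> 'rV[R]_n) : Prop :=
  continuous f /\
  forall c, atlas c -> smooth_on (chart_img c) (f \o chart_inv c).

Definition immersion (R : realType) (n : nat) (M : surface R)
    (f : M -> 'rV[R]_n) : Prop :=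
  smooth_map f /\
  forall c, atlas c -> forall u, chart_img c u ->
    injective ('d (f \o chart_inv c) u).

Definition proper_map (S T : topologicalType) (f : S -> T) : Prop :=
  continuous f /\ forall K : set T, compact K -> compact (f @^-1` K).

Definition inner (R : realType) (n : nat) (g : 'rV[R]_n -> 'M[R]_n)
    (p v w : 'rV[R]_n) : R :=
  (v *m g p *m w^T) 0 0.

(* Christoffel symbols of the Levi-Civita connection:
   Gamma^k_ij = 1/2 sum_l g^kl (d_i g_jl + d_j g_il - d_l g_ij). *)
Definition christoffel (R : realType) (n : nat) (g : 'rV[R]_n -> 'M[R]_n)
    (k i j : 'I_n) (p : 'rV[R]_n) : R :=
  let dg (a b c : 'I_n) : R := 'D_(delta_mx 0 a) (fun q => g q b c) p in
  2^-1 * \sum_l invmx (g p) k l * (dg i j l + dg j i l - dg l i j).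

(* The covariant derivative of d_b X in the direction d_a X, in coordinates. *)
Definition cov_hessian (R : realType) (n : nat) (g : 'rV[R]_n -> 'M[R]_n)
    (X : 'rV[R]_2 -> 'rV[R]_n) (a b : 'I_2) (u : 'rV[R]_2) : 'rV[R]_n :=
  partial a (partial b X) u +
  \row_k \sum_i \sum_j
    christoffel g k i j (X u) * partial a X u 0 i * partial b X u 0 j.

Definition first_form (R : realType) (n : nat) (g : 'rV[R]_n -> 'M[R]_n)
    (X : 'rV[R]_2 -> 'rV[R]_n) (u : 'rV[R]_2) : 'M[R]_2 :=
  \matrix_(a, b) inner g (X u) (partial a X u) (partial b X u).

(* g-orthogonal projection onto the normal space of the surface at X u. *)
Definition normal_part (R : realType) (n : nat) (g : 'rV[R]_n -> 'M[R]_n)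
    (X : 'rV[R]_2 -> 'rV[R]_n) (u : 'rV[R]_2) (v : 'rV[R]_n) : 'rV[R]_n :=
  v - \sum_a \sum_b
    (invmx (first_form g X u) a b * inner g (X u) v (partial a X u))
      *: partial b X u.

Definition second_form (R : realType) (n : nat) (g : 'rV[R]_n -> 'M[R]_n)
    (X : 'rV[R]_2 -> 'rV[R]_n) (u : 'rV[R]_2) (a b : 'I_2) : 'rV[R]_n :=
  normal_part g X u (cov_hessian g X a b u).

(* For n = 3 this is H nu, with nu a unit normal and H the mean curvature with
   respect to nu; the product does not depend on the choice of nu. *)
Definition mean_curvature_vector (R : realType) (n : nat)
    (g : 'rV[R]_n -> 'M[R]_n) (X : 'rV[R]_2 -> 'rV[R]_n) (u : 'rV[R]_2) :
    'rV[R]_n :=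
  2^-1 *: \sum_a \sum_b invmx (first_form g X u) a b *: second_form g X u a b.

Definition minimal_immersion (R : realType) (n : nat)
    (g : 'rV[R]_n -> 'M[R]_n) (M : surface R) (f : M -> 'rV[R]_n) : Prop :=
  immersion f /\
  forall c, atlas c -> forall u, chart_img c u ->
    mean_curvature_vector g (f \o chart_inv c) u = 0.

Definition properly_immersed_minimal_surface (R : realType) (n : nat)
    (g : 'rV[R]_n -> 'M[R]_n) (S : set 'rV[R]_n) : Prop :=
  exists (M : surface R) (f : M -> 'rV[R]_n),
    [/\ [set: M] !=set0, connected [set: M],
        minimal_immersion g f, proper_map f & S = range f].

(* A point (x1, x2, s) is the row vector with these entries. *)
Definition sol_s (R : realType) (p : 'rV[R]_3) : R := p 0 ord_max.

Definition sol_metric (R : realType) (p : 'rV[R]_3) : 'M[R]_3 :=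
  diag_mx (\row_k [:: expR (2 * sol_s p); expR (- 2 * sol_s p); 1]`_k).

Definition special_plane (R : realType) (t : R) : set 'rV[R]_3 :=
  [set p | sol_s p = t].

Definition on_one_side (R : realType) (S : set 'rV[R]_3) (t : R) : Prop :=
  (forall p, S p -> t <= sol_s p) \/ (forall p, S p -> sol_s p <= t).

(* Main.v *)
Require Import Defs.
From mathcomp Require Import ring lra.

(** Let w = sg * s with sg = 1 or sg = -1, so that the surface S lies in
    w >= c.  The theorem says that w is then constant on S.

    The tool is the family of barriers
      F(p) = - exp(- 2 w) + eta * ln q,
      q = e^(2s) (x1 - a)^2 + e^(-2s) (x2 - b)^2,
    with a small eta > 0.  At each fixed height q is the squared distance to
    the vertical line over (a, b), and its logarithm is harmonic for the flat
    metric of that special plane, while - exp(- 2 w) is strictly concave in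
    the height.  If F restricted to S had a local minimum, S would be tangent
    there to a level set of F and, S being minimal, the trace of Hess F on the
    kernel of dF would be nonnegative.  That trace can be computed exactly
    ([barrier_trace]): up to a positive factor it is
      - 4 e + 2 sg k e + eta (4 - 2 k^2 + 2 / q),
      e = exp(- 2 w),  |k| <= 1,
    which is negative when eta (4 + 2 / q) < 2 e.  Hence the barriers have no
    local minimum on a minimal surface ([no_interior_min]).  This touching
    principle, which only needs the first and second derivative tests along
    two directions, is used twice with eta going to 0.

    The infimum m0 of w is attained ([lower_bound_attained]).  Otherwise
    properness keeps w away from m0 over the compact part q <= 1 of the slab
    m0 <= w <= m0 + 1, so that q > 1 at all points of S with w <= m0 + d.
    A point with w < m0 + d and a small eta give F a value below its values on
    w = m0 + d; as ln q is proper on the slab, F then has a minimum on S at a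
    point with w < m0 + d.

    The contact set w = m0 is open ([contact_set_open]).  This is the interior
    ball argument of Hopf: near a contact point that is not interior to the
    contact set, the coordinates (x1, x2) embed the surface, some horizontal
    disc around (a, b) meets the contact set in exactly one point z, which is
    on its boundary circle, and for small eta the barrier is larger on a small
    sphere around z than at z.

    The contact set is also closed, so by connectedness S lies in a special
    plane.  It fills that plane: given a point of the plane, properness
    provides a nearest point of S, and since S is immersed the distance has no
    critical point except where it vanishes. *)

Set Implicit Arguments.
Unset Strict Implicit.
Unset Printing Implicit Defensive.

Import Order.TTheory GRing.Theory Num.Theory.
Import numFieldNormedType.Exports.
Local Open Scope classical_set_scope.
Local Open Scope ring_scope.

(** * Small dimensions *)

Lemma ord2P (i : 'I_2) : i = 0 \/ i = 1.
Proof. by case: i => -[|[|//]] ?; [left|right]; apply: val_inj. Qed.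

Lemma ord3P (i : 'I_3) : [\/ i = 0, i = 1 | i = ord_max].
Proof.
by case: i => -[|[|[|//]]] ?;
  [constructor 1|constructor 2|constructor 3]; apply: val_inj.
Qed.

Lemma sum_I2 (V : nmodType) (f : 'I_2 -> V) : \sum_i f i = f 0 + f 1.
Proof. by rewrite big_ord_recl big_ord1; congr (_ + f _); apply: val_inj. Qed.

Lemma sum_I3 (V : nmodType) (f : 'I_3 -> V) :
  \sum_i f i = f 0 + f 1 + f ord_max.
Proof.
rewrite !big_ord_recl big_ord0 addr0 addrA.
by congr (_ + f _ + f _); apply: val_inj.
Qed.

Lemma det2_ker0 (R : realFieldType) (a b c d v w : R) : a * d - b * c != 0 ->
  v * a + w * b = 0 -> v * c + w * d = 0 -> v = 0 /\ w = 0.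
Proof.
move=> det0 ab cd; split; apply: (mulfI det0); rewrite mulr0.
  transitivity (d * (v * a + w * b) - b * (v * c + w * d)); first by ring.
  by rewrite ab cd !mulr0 subrr.
transitivity (a * (v * c + w * d) - c * (v * a + w * b)); first by ring.
by rewrite ab cd !mulr0 subrr.
Qed.

Lemma invmx2 (R : fieldType) (G : 'M[R]_2) (D := G 0 0 * G 1 1 - G 0 1 * G 1 0) :
  D != 0 ->
  [/\ invmx G 0 0 = G 1 1 / D, invmx G 0 1 = - G 0 1 / D,
      invmx G 1 0 = - G 1 0 / D & invmx G 1 1 = G 0 0 / D].
Proof.
move=> D0.
pose A : 'M[R]_2 :=
  \matrix_(i, j) ((if i == j then G (1 - i) (1 - i) else - G i j) / D).
have i10 : 1 - 0 = 1 :> 'I_2 by apply: val_inj.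
have i11 : 1 - 1 = 0 :> 'I_2 by apply: val_inj.
have GA : G *m A = 1%:M.
  apply/matrixP => i j; rewrite !mxE sum_I2 !mxE.
  have [->|->] := ord2P i.
    have [->|->] := ord2P j.
      by rewrite /= i10 /D; field.
    by rewrite /= i11 /D; field.
  have [->|->] := ord2P j.
    by rewrite /= i10 /D; field.
  by rewrite /= i11 /D; field.
have [uG _] := mulmx1_unit GA.
have -> : invmx G = A by rewrite -[RHS]mul1mx -(mulVmx uG) -mulmxA GA mulmx1.
by split; rewrite mxE /= ?i10 ?i11.
Qed.

(** * Derivatives along curves and lines *)

(** Unlike [is_derive], this is not a type class: the value of the derivative
    stays an evar that is filled in by the rules below. *)
Definition der (R : realType) (t : R) (f : R -> R) (a : R) := is_derive t 1 f a.

Section DeriveRules.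
Variables (R : realType) (t : R).
Implicit Types f g : R -> R.
Lemma der_cst (c : R) : der t (fun _ : R => c) 0.
Proof. exact: is_derive_cst. Qed.
Lemma der_add f g a b : der t f a -> der t g b ->
  der t (fun t => f t + g t) (a + b).
Proof. by move=> df dg; exact: is_deriveD. Qed.
Lemma der_opp f a : der t f a -> der t (fun t => - f t) (- a).
Proof. by move=> df; exact: is_deriveN. Qed.
Lemma der_mul f g a b : der t f a -> der t g b ->
  der t (fun t => f t * g t) (f t * b + g t * a).
Proof. by move=> df dg; exact: is_deriveM. Qed.
Lemma der_scale (c : R) f a : der t f a -> der t (fun t => c * f t) (c * a).
Proof. by move=> df; exact: is_deriveZ. Qed.
Lemma der_shift (c : R) f a : der t f a -> der t (fun t => f t - c) a.
Proof. by move=> df; apply: (is_derive_eq (is_deriveB df (der_cst c))); rewrite subr0. Qed.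
Lemma der_eq f a b : der t f a -> a = b -> der t f b.
Proof. by move=> df <-. Qed.
Lemma der_sqr f a : der t f a ->
  der t (fun t => f t ^+ 2) (2 * f t * a).
Proof.
move=> df; have -> : (fun t => f t ^+ 2) = (fun t => f t * f t).
  by apply/funext => z; rewrite expr2.
apply: der_eq; [exact: (der_mul df df)|ring].
Qed.
Lemma der_inv f a : f t != 0 -> der t f a ->
  der t (fun t => (f t)^-1) (- a / f t ^+ 2).
Proof.
move=> ft0 df; apply: (der_eq (is_deriveV ft0 df)).
by rewrite /GRing.scale /=; field.
Qed.
Lemma der_expR f a : der t f a ->
  der t (fun t => expR (f t)) (expR (f t) * a).
Proof. by move=> df; exact: is_derive1_comp. Qed.
Lemma der_ln f a : 0 < f t -> der t f a ->
  der t (fun t => ln (f t)) (a / f t).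
Proof.
move=> ft0 df; have dl := is_derive1_ln ft0.
by apply: (der_eq (is_derive1_comp dl df)); rewrite mulrC.
Qed.

End DeriveRules.

Lemma first_derivative_test (R : realType) (f f' : R -> R) (r : R) :
  0 < r -> (forall t : R, `|t| < r -> is_derive t 1 f (f' t)) ->
  (forall t, `|t| < r -> f 0 <= f t) -> f' 0 = 0.
Proof.
move=> r0 df fmin.
have rr : - r <= r by lra.
have h0 : 0 \in `]-r, r[ by rewrite in_itv /=; lra.
have d0 : is_derive (0 : R) 1 f 0.
  apply: (derive1_at_min rr _ h0) => t; rewrite in_itv /= => /andP[t1 t2].
    by have [] := df t; first by rewrite ltr_norml t1.
  by apply: fmin; rewrite ltr_norml t1.
have [_ e0] := d0; have := df 0; rewrite normr0 => /(_ r0)[_ <-].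
by rewrite e0.
Qed.

(** Only the existence of f'' at 0 is available, so the sign comes from the
    mean value theorem applied to f. *)
Lemma second_derivative_test (R : realType) (f f' : R -> R) (c r : R) :
  0 < r -> (forall t : R, `|t| < r -> is_derive t 1 f (f' t)) ->
  is_derive (0 : R) 1 f' c -> (forall t, `|t| < r -> f 0 <= f t) ->
  f' 0 = 0 /\ 0 <= c.
Proof.
move=> r0 df df' fmin.
have f'0 := first_derivative_test r0 df fmin.
split=> //; rewrite leNgt; apply/negP => c0.
have [d1 d2] := df'.
have cv : h^-1 *: ((f' \o shift 0) (h *: 1) - f' 0) @[h --> 0^'] --> c.
  by rewrite -d2; exact: d1.
have [e /= e0 eP] := cvgr_lt _ cv _ c0.
(* If c < 0, then f' is negative just to the right of 0 and f decreases. *)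
pose b := Num.min r e / 2.
have m0 : 0 < Num.min r e by rewrite lt_min r0.
have b0 : 0 < b by rewrite divr_gt0.
have bm : b < Num.min r e by rewrite /b; lra.
have [br be] : b < r /\ b < e by move: bm; rewrite lt_min => /andP[].
have dfb x : x \in `[0, b] -> is_derive x 1 f (f' x).
  rewrite in_itv /= => /andP[x0 xb].
  by apply: df; rewrite ger0_norm//; lra.
have fc : {within `[0, b], continuous f}.
  by apply: derivable_within_continuous => x xb; have [] := dfb x xb.
have dfo x : x \in `]0, b[ -> is_derive x 1 f (f' x).
  by move=> xb; apply: dfb; rewrite in_itv /= !ltW// (itvP xb).
have [x + fx] := MVT b0 dfo fc.
rewrite in_itv /= => /andP[x0 xb].
have fb : f 0 <= f b by apply: fmin; rewrite ger0_norm// ltW.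
have := eP x; rewrite /= sub0r normrN gtr0_norm// gt_eqF// => /(_ (lt_trans xb be) isT).
rewrite /GRing.scale /= mulr1 addr0 f'0 subr0 => q0.
have f'x : f' x < 0 by move: q0; rewrite pmulr_rlt0// invr_gt0.
have : f' x * (b - 0) < 0 by rewrite subr0 nmulr_rlt0.
by rewrite -fx; lra.
Qed.

Lemma smooth_differentiable (R : realType) m n (U : set 'rV[R]_m)
    (F : 'rV[R]_m -> 'rV[R]_n) u : smooth_on U F -> U u -> differentiable F u.
Proof. by move=> sF Uu; have [dF _] := sF 1%N; exact: dF. Qed.

Lemma is_derive_line (R : realType) (m n : nat) (F : 'rV[R]_m -> 'rV[R]_n)
    (u v : 'rV[R]_m) (t : R) (j : 'I_n) :
  differentiable F (u + t *: v) ->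
  is_derive t 1 (fun t => F (u + t *: v) 0 j)
    (\sum_a v 0 a * partial a F (u + t *: v) 0 j).
Proof.
move=> dF; set p := u + t *: v.
have derF : derivable F p v by exact: diff_derivable.
have E : (fun h : R => h^-1 *: (((fun t => F (u + t *: v) 0 j) \o shift t) (h *: 1)
            - F (u + t *: v) 0 j)) =
         (fun h : R => h^-1 *: (((fun p => F p 0 j) \o shift p) (h *: v)
            - F p 0 j)).
  apply/funext => h /=; congr (_ *: (F _ 0 j - _)).
  have -> : h *: (1 : R) = h by rewrite /GRing.scale /= mulr1.
  by rewrite /p scalerDl addrCA.
have /derivable_mxP derc := derF.
apply: DeriveDef; first by rewrite /derivable E; exact: (derc 0 j).
rewrite /derive E.
transitivity ('D_v (fun p => F p 0 j) p); first by [].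
have := derive_mx derF.
move=> /(congr1 (fun M : 'rV[R]_n => M 0 j)).
rewrite mxE => <-.
rewrite deriveE//.
rewrite [in LHS](row_sum_delta v) linear_sum summxE.
apply: eq_bigr => a _.
by rewrite linearZ mxE /partial deriveE.
Qed.

Lemma derive_line (R : realType) (m : nat) (f : 'rV[R]_m -> R) (p v : 'rV[R]_m) :
  'D_v f p = 'D_1 (fun h : R => f (p + h *: v)) 0.
Proof.
rewrite /derive; set g1 := fun h => h^-1 *: _; set g2 := fun h => h^-1 *: _.
suff -> : g1 = g2 by [].
apply/funext => h; rewrite /g1 /g2 /= scale0r !addr0.
have -> : h *: (1 : R) = h by rewrite /GRing.scale /= mulr1.
by rewrite [h *: v + p]addrC.
Qed.

Lemma near_line (R : realType) (m : nat) (U : set 'rV[R]_m) (u v : 'rV[R]_m) :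
  nbhs u U -> exists2 r : R, 0 < r & forall t : R, `|t| < r -> U (u + t *: v).
Proof.
move=> /nbhs_ballP[e /= e0 eU].
have v1 : 0 < `|v| + 1 by rewrite ltr_wpDl.
exists (e / (`|v| + 1)); first by rewrite divr_gt0.
move=> t te; apply: eU; rewrite -ball_normE /= opprD addrA subrr sub0r normrN normrZ.
rewrite ltr_pdivlMr// in te; apply: le_lt_trans te.
by rewrite ler_wpM2l// lerDl.
Qed.

Section Along.
Variables (R : realType) (n : nat) (U : set 'rV[R]_2) (X : 'rV[R]_2 -> 'rV[R]_n).
Hypothesis sX : smooth_on U X.
Variables (u v : 'rV[R]_2).

Definition line_velocity (k : 'I_n) (t : R) : R :=
  v 0 0 * partial 0 X (u + t *: v) 0 k + v 0 1 * partial 1 X (u + t *: v) 0 k.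

Definition line_acceleration (k : 'I_n) : R :=
  v 0 0 * (v 0 0 * partial 0 (partial 0 X) u 0 k + v 0 1 * partial 1 (partial 0 X) u 0 k)
  + v 0 1 * (v 0 0 * partial 0 (partial 1 X) u 0 k + v 0 1 * partial 1 (partial 1 X) u 0 k).

Lemma der_line k t : U (u + t *: v) ->
  der t (fun t => X (u + t *: v) 0 k) (line_velocity k t).
Proof.
move=> Ut; have := is_derive_line k (smooth_differentiable sX Ut).
by rewrite sum_I2.
Qed.

Lemma der_line_velocity k : U u -> der 0 (line_velocity k) (line_acceleration k).
Proof.
move=> Uu; have [_ dX] := sX 2%N.
have dp a : der 0 (fun t => partial a X (u + t *: v) 0 k)
   (v 0 0 * partial 0 (partial a X) u 0 k + v 0 1 * partial 1 (partial a X) u 0 k).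
  have [da _] := dX a.
  have U0 : U (u + 0 *: v) by rewrite scale0r addr0.
  have := is_derive_line k (da _ U0).
  by rewrite sum_I2 scale0r addr0.
exact: (der_add (der_scale _ (dp 0)) (der_scale _ (dp 1))).
Qed.

End Along.

Lemma line_velocity_delta (R : realType) n (X : 'rV[R]_2 -> 'rV[R]_n) u i k :
  line_velocity X u (delta_mx 0 i) k 0 = partial i X u 0 k.
Proof.
rewrite /line_velocity scale0r addr0 !mxE /=.
by have [->|->] := ord2P i; rewrite /= ?mul1r ?mul0r ?addr0 ?add0r.
Qed.

(** * The metric and the minimal surface equation in coordinates *)

Definition sol_coef (R : realType) (s : R) (k : 'I_3) : R :=
  [:: expR (2 * s); expR (- 2 * s); 1]`_k.

Definition sol_coef' (R : realType) (s : R) (k : 'I_3) : R :=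
  [:: 2 * expR (2 * s); - 2 * expR (- 2 * s); 0]`_k.

Lemma sol_metricE (R : realType) (p : 'rV[R]_3) (b c : 'I_3) :
  sol_metric p b c = sol_coef (sol_s p) b *+ (b == c).
Proof. by rewrite !mxE; case: eqP => [->|]. Qed.

Lemma derive_sol_metric (R : realType) (p : 'rV[R]_3) (a b c : 'I_3) :
  'D_(delta_mx 0 a) (fun q => sol_metric q b c) p =
  (sol_coef' (sol_s p) b *+ (b == c)) *+ (a == ord_max).
Proof.
rewrite derive_line.
have -> : (fun h : R => sol_metric (p + h *: delta_mx 0 a) b c) =
    (fun h => sol_coef (sol_s p + h * (a == ord_max)%:R) b *+ (b == c)).
  by apply/funext => h; rewrite sol_metricE /sol_s !mxE eqxx /= (eq_sym a).
case: (b == c) => /=; last by rewrite mul0rn derive_cst.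
have dl : der (0 : R) (fun h => sol_s p + h * (a == ord_max)%:R) (a == ord_max)%:R.
  apply: der_eq; first exact: (der_add (der_cst _ _) (der_mul (is_derive_id _ _) (der_cst _ _))).
  by rewrite /=; ring.
have dE (k : R) : der (0 : R) (fun h => expR (k * (sol_s p + h * (a == ord_max)%:R)))
    (k * expR (k * sol_s p) * (a == ord_max)%:R).
  apply: der_eq; first exact: (der_expR (der_mul (der_cst _ _) dl)).
  by rewrite /= mul0r addr0; ring.
rewrite mulr1n -[RHS]mulr_natr /sol_coef /sol_coef'.
case: b => -[|[|[|//]]] ? /=.
- by have [_ e] := dE 2; exact: e.
- by have [_ e] := dE (- 2); exact: e.
- by rewrite derive_cst mul0r.
Qed.

Lemma sol_coef_gt0 (R : realType) (s : R) k : 0 < sol_coef s k.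
Proof. by case: k => -[|[|[|//]]] ? /=; rewrite /sol_coef /= ?expR_gt0. Qed.

Lemma invmx_sol (R : realType) (p : 'rV[R]_3) k l :
  invmx (sol_metric p) k l = (sol_coef (sol_s p) k)^-1 *+ (k == l).
Proof.
have e : sol_metric p *m diag_mx (\row_k (sol_coef (sol_s p) k)^-1) = 1%:M.
  rewrite mulmx_diag; apply/matrixP => i j; rewrite !mxE.
  case: eqP => // -> /=; rewrite mulfV//.
  by rewrite gt_eqF// (sol_coef_gt0 _ j).
have [u _] := mulmx1_unit e.
have -> : invmx (sol_metric p) = diag_mx (\row_k (sol_coef (sol_s p) k)^-1).
  by rewrite -[RHS]mul1mx -(mulVmx u) -mulmxA e mulmx1.
by rewrite !mxE.
Qed.

Lemma christoffel_sol (R : realType) (p : 'rV[R]_3) (k i j : 'I_3) :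
  christoffel (@sol_metric R) k i j p =
  2^-1 * ((sol_coef (sol_s p) k)^-1 *
   (sol_coef' (sol_s p) k *+ (j == k) *+ (i == ord_max) +
    sol_coef' (sol_s p) k *+ (i == k) *+ (j == ord_max) -
    sol_coef' (sol_s p) i *+ (i == j) *+ (k == ord_max))).
Proof.
rewrite /christoffel; congr (_ * _).
rewrite (bigD1 k)//= big1 ?addr0; last first.
  by move=> l lk; rewrite invmx_sol eq_sym (negbTE lk) mul0r.
rewrite invmx_sol eqxx mulr1n !derive_sol_metric; congr (_ * (_ + _ - _)).
  by case: eqP => [->|].
by case: eqP => [->|].
Qed.

(** The connection terms of the covariant Hessian of a surface in Sol: the
    Christoffel symbols that do not vanish are 1, -1, - e^(2s) and e^(-2s). *)
Lemma sum_christoffel_sol (R : realType) (p v w : 'rV[R]_3) (k : 'I_3) 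
  (s := sol_s p) (v0 := v 0 0) (v1 := v 0 1) (v2 := v 0 ord_max)
  (w0 := w 0 0) (w1 := w 0 1) (w2 := w 0 ord_max) :
  \sum_i \sum_j christoffel (@sol_metric R) k i j p * v 0 i * w 0 j =
  [:: v0 * w2 + v2 * w0; - (v1 * w2 + v2 * w1);
     - expR s ^+ 2 * v0 * w0 + expR s ^- 2 * v1 * w1]`_k.
Proof.
have e1 : lift ord0 (ord0 : 'I_2) = 1 :> 'I_3 by apply: val_inj.
have e2 : lift ord0 (lift ord0 (ord0 : 'I_1)) = ord_max :> 'I_3 by apply: val_inj.
rewrite !big_ord_recl !big_ord0 !e1 !e2 !christoffel_sol.
have E2 : expR (2 * s) = expR s ^+ 2 by rewrite -expRM_natl.
have E2' : expR (-2 * s) = expR s ^- 2 by rewrite mulNr expRN E2.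
have E0 : expR s != 0 by rewrite gt_eqF ?expR_gt0.
case: k => -[|[|[|//]]] ? /=; rewrite /sol_coef /sol_coef' /= -/s ?E2 ?E2' -/v0 -/v1 -/v2 -/w0 -/w1 -/w2.
- by rewrite !mulr0n !mulr1n; field.
- by rewrite !mulr0n !mulr1n; field.
- by rewrite !mulr0n !mulr1n; field.
Qed.

Lemma inner_sol (R : realType) (q v w : 'rV[R]_3) (E := expR (sol_s q)) :
  inner (@sol_metric R) q v w =
   (E * v 0 0) * (E * w 0 0) + (v 0 1 / E) * (w 0 1 / E) + v 0 ord_max * w 0 ord_max.
Proof.
have E0 : E != 0 by rewrite gt_eqF ?expR_gt0.
rewrite /inner /sol_metric mul_mx_diag mxE sum_I3 !mxE /= mulNr expRN expRM_natl -/E.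
by field.
Qed.

(** The Gram determinant is the squared length of the cross product of the two
    vectors, written in the orthonormal frame e^(-s) d1, e^s d2, d3. *)
Lemma sol_gram_gt0 (R : realType) (q p0 p1 : 'rV[R]_3)
  (I := inner (@sol_metric R) q) :
  (forall v0 v1 : R, v0 *: p0 + v1 *: p1 = 0 -> v0 = 0 /\ v1 = 0) ->
  0 < I p0 p0 * I p1 p1 - I p0 p1 ^+ 2.
Proof.
move=> free; have E0 : expR (sol_s q) != 0 by rewrite gt_eqF ?expR_gt0.
have ext (v0 v1 : R) : v0 * p0 0 0 + v1 * p1 0 0 = 0 ->
    v0 * p0 0 1 + v1 * p1 0 1 = 0 ->
    v0 * p0 0 ord_max + v1 * p1 0 ord_max = 0 -> v0 = 0 /\ v1 = 0.
  move=> h0 h1 h2; apply: free; apply/rowP => k; rewrite !mxE.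
  by have [->|->|->] := ord3P k.
rewrite /I !inner_sol; move: (expR (sol_s q)) E0 => E E0.
move: ext; move: (p0 0 0) (p0 0 1) (p0 0 ord_max) (p1 0 0) (p1 0 1) (p1 0 ord_max).
move=> a1 a2 a3 b1 b2 b3 ext.
rewrite [ltRHS](_ : _ = ((a2 * b3 - a3 * b2) / E) ^+ 2 + (E * (a3 * b1 - a1 * b3)) ^+ 2
  + (a1 * b2 - a2 * b1) ^+ 2); last by field.
rewrite lt_def !addr_ge0 ?sqr_ge0// andbT; apply/negP.
rewrite !paddr_eq0 ?addr_ge0 ?sqr_ge0// !expf_eq0 /= !mulf_eq0.
rewrite invr_eq0 (negbTE E0) orbF /= !subr_eq0.
move=> /andP[/andP[/eqP e1 /eqP e2] /eqP e3].
(* All 2 x 2 minors vanish, so b_i a - a_i b = 0 for each i. *)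
have b0 : b1 = 0 /\ b2 = 0 /\ b3 = 0.
  split; [|split].
  - by have [||| h _ //] := ext b1 (- a1); lra.
  - by have [||| h _ //] := ext b2 (- a2); lra.
  - by have [||| h _ //] := ext b3 (- a3); lra.
have [b10 [b20 b30]] := b0.
have [||| _ /eqP] := ext 0 1; rewrite ?b10 ?b20 ?b30 ?mulr0 ?mul0r ?addr0//.
by rewrite oner_eq0.
Qed.

Lemma sol_gram_neq0 (R : realType) (q p0 p1 : 'rV[R]_3)
  (I := inner (@sol_metric R) q) :
  (forall v0 v1 : R, v0 *: p0 + v1 *: p1 = 0 -> v0 = 0 /\ v1 = 0) ->
  I p0 p0 * I p1 p1 - I p0 p1 * I p1 p0 != 0.
Proof.
move=> free; have -> : I p1 p0 = I p0 p1 by rewrite /I !inner_sol; ring.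
by rewrite -expr2 gt_eqF// sol_gram_gt0.
Qed.

Lemma diff_partial (R : realType) n (X : 'rV[R]_2 -> 'rV[R]_n) (u v : 'rV[R]_2) :
  differentiable X u -> 'd X u v = v 0 0 *: partial 0 X u + v 0 1 *: partial 1 X u.
Proof.
move=> dX.
by rewrite [in LHS](row_sum_delta v) linear_sum sum_I2 !linearZ /partial !deriveE.
Qed.

Lemma immersion_free (R : realType) n (X : 'rV[R]_2 -> 'rV[R]_n) (u : 'rV[R]_2) :
  differentiable X u -> injective ('d X u) ->
  forall v0 v1 : R, v0 *: partial 0 X u + v1 *: partial 1 X u = 0 -> v0 = 0 /\ v1 = 0.
Proof.
move=> dX inj v0 v1 v01.
pose v : 'rV[R]_2 := \row_i (if i == 0 then v0 else v1).
have : 'd X u v = 'd X u 0 by rewrite diff_partial// !mxE /= v01 linear0.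
by move=> /inj /rowP vE; split; [have := vE 0|have := vE 1]; rewrite !mxE.
Qed.

(** Where the surface is horizontal, (x1, x2) is a local coordinate system. *)
Lemma horizontal_det_neq0 (R : realType) (p0 p1 : 'rV[R]_3) :
  (forall v0 v1 : R, v0 *: p0 + v1 *: p1 = 0 -> v0 = 0 /\ v1 = 0) ->
  p0 0 ord_max = 0 -> p1 0 ord_max = 0 ->
  p0 0 0 * p1 0 1 - p1 0 0 * p0 0 1 != 0.
Proof.
move=> free z0 z1; apply/eqP => d0.
have ext (v0 v1 : R) : v0 * p0 0 0 + v1 * p1 0 0 = 0 ->
    v0 * p0 0 1 + v1 * p1 0 1 = 0 -> v0 = 0 /\ v1 = 0.
  move=> h0 h1; apply: free; apply/rowP => k; rewrite !mxE.
  by have [->|->|->] := ord3P k => //; rewrite z0 z1 !mulr0 addr0.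
have [||a0 b0] := ext (p1 0 0) (- p0 0 0); [by ring|by rewrite -[RHS]oppr0 -d0; ring|].
have [||a1 b1] := ext (p1 0 1) (- p0 0 1); [by rewrite -[RHS]d0; ring|by ring|].
move: b0 b1 => /eqP; rewrite oppr_eq0 => /eqP b0 /eqP; rewrite oppr_eq0 => /eqP b1.
have [||/eqP + _] := ext 1 0; rewrite ?b0 ?b1; [by ring|by ring|].
by rewrite oner_eq0.
Qed.

(** Minimality says that the trace of the covariant Hessian of X for the first
    fundamental form is tangent to the surface.  After multiplication by the
    determinant, the inverse of that form becomes its adjugate. *)
Lemma minimal_trace (R : realType) (n : nat) (g : 'rV[R]_n -> 'M[R]_n)
    (X : 'rV[R]_2 -> 'rV[R]_n) (u : 'rV[R]_2)
    (G := fun a b => inner g (X u) (partial a X u) (partial b X u))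
    (T := fun a b => cov_hessian g X a b u) :
  G 0 0 * G 1 1 - G 0 1 * G 1 0 != 0 ->
  mean_curvature_vector g X u = 0 ->
  exists c : 'I_2 -> R, forall k,
    G 1 1 * T 0 0 0 k - G 0 1 * T 0 1 0 k - G 1 0 * T 1 0 0 k
      + G 0 0 * T 1 1 0 k =
    c 0 * partial 0 X u 0 k + c 1 * partial 1 X u 0 k.
Proof.
move=> D0 H0.
have GE a b : first_form g X u a b = G a b by rewrite mxE.
have := @invmx2 R (first_form g X u); rewrite !GE => /(_ D0)[A00 A01 A10 A11].
have : \sum_a \sum_b invmx (first_form g X u) a b *: second_form g X u a b = 0.
  have : (2 : R)^-1 != 0 by rewrite invr_eq0 pnatr_eq0.
  by move/(_ : _ -> injective _)/(_ _ 0); apply => //; [exact: scalerI|rewrite scaler0].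
rewrite [LHS]sum_I2.
rewrite [X in X + _]sum_I2 [X in _ + X]sum_I2.
rewrite A00 A01 A10 A11.
have tE a b : exists c : 'I_2 -> R, second_form g X u a b =
    T a b - (c 0 *: partial 0 X u + c 1 *: partial 1 X u).
  exists (fun b0 => \sum_a0
    invmx (first_form g X u) a0 b0 * inner g (X u) (T a b) (partial a0 X u)).
  rewrite /second_form /normal_part; congr (_ - _).
  by rewrite exchange_big /= sum_I2 !scaler_suml.
have [c00 ->] := tE 0 0; have [c01 ->] := tE 0 1.
have [c10 ->] := tE 1 0; have [c11 ->] := tE 1 1.
move: D0 {tE}.
move: (G 0 0) (G 0 1) (G 1 0) (G 1 1) (T 0 0) (T 0 1) (T 1 0) (T 1 1)
  (partial 0 X u) (partial 1 X u) => g00 g01 g10 g11 t00 t01 t10 t11 p0 p1 D0.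
move=> /rowP HH.
exists (fun i => g11 * c00 i - g01 * c01 i - g10 * c10 i + g00 * c11 i) => k.
move: (HH k); rewrite !mxE => {}HH.
apply/eqP; rewrite -subr_eq0 -(mulrI_eq0 _ (mulfI (invr_neq0 D0))); apply/eqP.
by rewrite -[RHS]HH; field.
Qed.

(** * The barrier *)

(** The squared length, at height s, of the horizontal vector (x, y). *)
Definition hnorm2 (R : realType) (x y s : R) : R :=
  (expR s * x) ^+ 2 + (y / expR s) ^+ 2.

(** The first and second derivatives of [hnorm2] along a curve, as functions of the
    position, velocity and acceleration of the curve. *)
Definition dhnorm2 (R : realType) (x y s x' y' s' : R) : R :=
  2 * (expR s ^+ 2 * (s' * x ^+ 2 + x * x') + expR s ^- 2 * (- s' * y ^+ 2 + y * y')).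

Definition ddhnorm2 (R : realType) (x y s x' y' s' x'' y'' s'' : R) : R :=
  2 * (expR s ^+ 2 * (2 * s' * (s' * x ^+ 2 + x * x') + s'' * x ^+ 2
         + 2 * s' * x * x' + x' ^+ 2 + x * x'') +
       expR s ^- 2 * (- 2 * s' * (- s' * y ^+ 2 + y * y') - s'' * y ^+ 2
         - 2 * s' * y * y' + y' ^+ 2 + y * y'')).

(** The barrier with its axis at the origin, and then its first and second
    derivatives along a curve. *)
Definition profile (R : realType) (sg eta x y s : R) : R :=
  - expR (- 2 * sg * s) + eta * ln (hnorm2 x y s).

Definition dprofile (R : realType) (sg eta x y s x' y' s' : R) : R :=
  2 * sg * expR (- 2 * sg * s) * s' + eta * (dhnorm2 x y s x' y' s' / hnorm2 x y s).

Definition ddprofile (R : realType) (sg eta x y s x' y' s' x'' y'' s'' : R) : R :=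
  2 * sg * expR (- 2 * sg * s) * s'' - 4 * sg ^+ 2 * expR (- 2 * sg * s) * s' ^+ 2 +
   eta * (ddhnorm2 x y s x' y' s' x'' y'' s'' / hnorm2 x y s
    - dhnorm2 x y s x' y' s' ^+ 2 / hnorm2 x y s ^+ 2).

Definition hdist2 (R : realType) (a b : R) (p : 'rV[R]_3) : R :=
  hnorm2 (p 0 0 - a) (p 0 1 - b) (sol_s p).

Definition barrier (R : realType) (sg eta a b : R) (p : 'rV[R]_3) : R :=
  profile sg eta (p 0 0 - a) (p 0 1 - b) (sol_s p).

Section ProfileAlongCurve.
Variables (R : realType) (x y s x' y' s' : R -> R) (x'' y'' s'' : R) (t : R).
Hypothesis dx : der t x (x' t).
Hypothesis dy : der t y (y' t).
Hypothesis ds : der t s (s' t).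

Lemma der_hnorm2 : der t (fun t => hnorm2 (x t) (y t) (s t))
  (dhnorm2 (x t) (y t) (s t) (x' t) (y' t) (s' t)).
Proof.
have E0 r : expR (s r) != 0 by rewrite gt_eqF ?expR_gt0.
rewrite /hnorm2; apply: der_eq.
  apply: der_add; apply: der_sqr; apply: der_mul; [exact: (der_expR ds)|exact: dx|exact: dy|].
  exact: (der_inv (f := fun r => expR (s r)) (E0 t) (der_expR ds)).
by rewrite /dhnorm2; field.
Qed.

Lemma der_profile sg eta : 0 < hnorm2 (x t) (y t) (s t) ->
  der t (fun t => profile sg eta (x t) (y t) (s t))
  (dprofile sg eta (x t) (y t) (s t) (x' t) (y' t) (s' t)).
Proof.
move=> q0.
rewrite /profile; apply: der_eq.
  apply: der_add.
    by apply: der_opp; apply: der_expR; apply: der_mul; [exact: der_cst|exact: ds].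
  by apply: der_mul; [exact: der_cst|exact: (der_ln (f := fun r => hnorm2 (x r) (y r) (s r)) q0 der_hnorm2)].
by rewrite /dprofile; field; rewrite gt_eqF.
Qed.

Hypothesis ddx : der t x' x''.
Hypothesis ddy : der t y' y''.
Hypothesis dds : der t s' s''.

Lemma der_dhnorm2 : der t (fun t => dhnorm2 (x t) (y t) (s t) (x' t) (y' t) (s' t))
  (ddhnorm2 (x t) (y t) (s t) (x' t) (y' t) (s' t) x'' y'' s'').
Proof.
have E0 r : expR (s r) != 0 by rewrite gt_eqF ?expR_gt0.
have E20 r : expR (s r) ^+ 2 != 0 by rewrite expf_neq0.
have dE2 := der_sqr (der_expR ds).
rewrite /dhnorm2; apply: der_eq.
  apply: (der_mul (der_cst _ _)).
  apply: der_add.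
    apply: (der_mul dE2).
    exact: (der_add (der_mul dds (der_sqr dx)) (der_mul dx ddx)).
  apply: (der_mul (der_inv (f := fun r => expR (s r) ^+ 2) (E20 t) dE2)).
  exact: (der_add (der_mul (der_opp dds) (der_sqr dy)) (der_mul dy ddy)).
by rewrite /ddhnorm2; field.
Qed.

Lemma der_dprofile sg eta : 0 < hnorm2 (x t) (y t) (s t) ->
  der t (fun t => dprofile sg eta (x t) (y t) (s t) (x' t) (y' t) (s' t))
  (ddprofile sg eta (x t) (y t) (s t) (x' t) (y' t) (s' t) x'' y'' s'').
Proof.
move=> q0; have q1 : hnorm2 (x t) (y t) (s t) != 0 by rewrite gt_eqF.
rewrite /dprofile; apply: der_eq.
  apply: der_add; apply: der_mul.
  - apply: der_mul; first exact: der_cst.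
    by apply: der_expR; apply: der_mul; [exact: der_cst|exact: ds].
  - exact: dds.
  - exact: der_cst.
  - apply: der_mul; first exact: der_dhnorm2.
    exact: (der_inv (f := fun r => hnorm2 (x r) (y r) (s r)) q1 der_hnorm2).
by rewrite /ddprofile /=; field.

Qed.

End ProfileAlongCurve.

(** The gradient and the covariant Hessian of the barrier, in the left-invariant
    orthonormal frame E1 = e^(-s) d1, E2 = e^s d2, E3 = d3.  Here p1 and p2 are
    the first two derivatives of the height term - exp(- 2 sg s), and (Y1, Y2)
    are the frame components of the horizontal position. *)
Section BarrierFrame.
Variables (R : realType) (sg eta x y s : R).
Let Y1 := expR s * x.
Let Y2 := y / expR s.
Let q := hnorm2 x y s.
Let p1 := 2 * sg * expR (- 2 * sg * s).
Let p2 := - 4 * sg ^+ 2 * expR (- 2 * sg * s).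

Definition grad1 := eta * (2 * Y1 / q).
Definition grad2 := eta * (2 * Y2 / q).
Definition grad3 := p1 + eta * (2 * (Y1 ^+ 2 - Y2 ^+ 2) / q).

Definition hess11 :=
  p1 + eta * (2 * (Y2 ^+ 2 - Y1 ^+ 2) / q ^+ 2 + 2 * (Y1 ^+ 2 - Y2 ^+ 2) / q).
Definition hess22 :=
  - p1 + eta * (2 * (Y1 ^+ 2 - Y2 ^+ 2) / q ^+ 2 - 2 * (Y1 ^+ 2 - Y2 ^+ 2) / q).
Definition hess33 := p2 + eta * (16 * Y1 ^+ 2 * Y2 ^+ 2 / q ^+ 2).
Definition hess12 := eta * (- 4 * Y1 * Y2 / q ^+ 2).
Definition hess13 := eta * (8 * Y1 * Y2 ^+ 2 / q ^+ 2 - 2 * Y1 / q).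
Definition hess23 := eta * (- 8 * Y1 ^+ 2 * Y2 / q ^+ 2 + 2 * Y2 / q).

Hypothesis q0 : 0 < q.
Let q0' : (expR s * x) ^+ 2 + (y / expR s) ^+ 2 != 0.
Proof. by rewrite gt_eqF. Qed.
Let E0 : expR s != 0. Proof. by rewrite gt_eqF ?expR_gt0. Qed.
Let q1' : expR s ^+ 2 * expR s ^+ 2 * x ^+ 2 + y ^+ 2 != 0.
Proof.
have -> : expR s ^+ 2 * expR s ^+ 2 * x ^+ 2 + y ^+ 2 =
  expR s ^+ 2 * ((expR s * x) ^+ 2 + (y / expR s) ^+ 2) by field.
by rewrite mulf_neq0// expf_neq0.
Qed.

Lemma dprofile_frame x' y' s' : dprofile sg eta x y s x' y' s' =
  grad1 * (expR s * x') + grad2 * (y' / expR s) + grad3 * s'.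
Proof.
rewrite /dprofile /grad1 /grad2 /grad3 /p1 /Y1 /Y2 /q /hnorm2 /dhnorm2.
move: (expR (- 2 * sg * s)) (expR s) E0 q1' => e E En qn.
by field; rewrite En /=; apply: contra qn => /eqP H; apply/eqP; rewrite -[RHS]H; ring.
Qed.

(** The chain rule: the gradient applied to the covariant acceleration of the
    curve, plus the Hessian applied twice to its velocity. *)
Lemma ddprofile_frame x' y' s' x'' y'' s'' :
  ddprofile sg eta x y s x' y' s' x'' y'' s'' =
  grad1 * (expR s * (x'' + 2 * x' * s')) + grad2 * ((y'' - 2 * y' * s') / expR s)
   + grad3 * (s'' - expR s ^+ 2 * x' ^+ 2 + expR s ^- 2 * y' ^+ 2)
   + (hess11 * (expR s * x') ^+ 2 + hess22 * (y' / expR s) ^+ 2 + hess33 * s' ^+ 2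
     + 2 * hess12 * (expR s * x') * (y' / expR s)
     + 2 * hess13 * (expR s * x') * s' + 2 * hess23 * (y' / expR s) * s').
Proof.
rewrite /ddprofile /grad1 /grad2 /grad3 /hess11 /hess22 /hess33 /hess12 /hess13 /hess23.
rewrite /p1 /p2 /Y1 /Y2 /q /hnorm2 /dhnorm2 /ddhnorm2.
move: (expR (- 2 * sg * s)) (expR s) E0 q1' => e E En qn.
by field; rewrite En /=; apply: contra qn => /eqP H; apply/eqP; rewrite -[RHS]H; ring.
Qed.

(** Up to the factor |N|^2, where N is the gradient, the left-hand side is the
    trace of the Hessian over the plane orthogonal to N.  Both s and ln q have
    a Hessian of trace zero over horizontal planes, so only the inclination of
    that plane counts; this gives the factor |(grad1, grad2)|^2 = 4 eta^2 / q. *)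
Lemma barrier_trace (k := (Y1 ^+ 2 - Y2 ^+ 2) / q) :
  (grad1 ^+ 2 + grad2 ^+ 2 + grad3 ^+ 2) * (hess11 + hess22 + hess33) -
    (hess11 * grad1 ^+ 2 + hess22 * grad2 ^+ 2 + hess33 * grad3 ^+ 2
     + 2 * hess12 * grad1 * grad2 + 2 * hess13 * grad1 * grad3
     + 2 * hess23 * grad2 * grad3)
  = 4 * eta ^+ 2 / q * (p2 + p1 * k + eta * (4 - 2 * k ^+ 2 + 2 / q)).
Proof.
rewrite /k /grad1 /grad2 /grad3 /hess11 /hess22 /hess33 /hess12 /hess13 /hess23.
rewrite /q /hnorm2 -/Y1 -/Y2; move: q0'; rewrite -/Y1 -/Y2 => qn.
by field.
Qed.

(** The strict concavity of - exp(- 2 sg s) in the height wins: the height terms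
    add up to at most - 2 exp(- 2 sg s). *)
Lemma barrier_trace_lt0 : sg ^+ 2 = 1 -> 0 < eta ->
  eta * (4 + 2 / q) < 2 * expR (- 2 * sg * s) ->
  (grad1 ^+ 2 + grad2 ^+ 2 + grad3 ^+ 2) * (hess11 + hess22 + hess33) -
    (hess11 * grad1 ^+ 2 + hess22 * grad2 ^+ 2 + hess33 * grad3 ^+ 2
     + 2 * hess12 * grad1 * grad2 + 2 * hess13 * grad1 * grad3
     + 2 * hess23 * grad2 * grad3) < 0.
Proof.
move=> sg2 e0 small; rewrite barrier_trace.
rewrite pmulr_rlt0; last by rewrite divr_gt0// mulr_gt0// exprn_gt0.
set k := (_ - _) / q.
have k1 : `|k| <= 1.
  rewrite normrM normfV (gtr0_norm q0) ler_pdivrMr// mul1r ler_norml.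
  by rewrite /q /hnorm2 -/Y1 -/Y2; have := sqr_ge0 Y1; have := sqr_ge0 Y2; lra.
have sgk : sg * k <= 1.
  rewrite (le_trans (ler_norm _))// normrM.
  suff -> : `|sg| = 1 by rewrite mul1r.
  by apply/eqP; rewrite -sqrp_eq1// -normrX sg2 normr1.
rewrite /p1 /p2 sg2.
have ee := expR_gt0 (- 2 * sg * s).
have h1 : 2 * sg * expR (- 2 * sg * s) * k <= 2 * expR (- 2 * sg * s).
  by rewrite (_ : 2 * sg * _ * k = 2 * expR (- 2 * sg * s) * (sg * k)); [rewrite ler_piMr// mulr_ge0// ltW|ring].
have h2 : eta * (4 - 2 * k ^+ 2 + 2 / q) <= eta * (4 + 2 / q).
  by rewrite ler_pM2l//; have := sqr_ge0 k; lra.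
by lra.
Qed.

End BarrierFrame.

Section Continuity.
Variables (R : realType) (sg eta a b : R).

Lemma continuous_sol_s : continuous (@sol_s R).
Proof. by move=> p; exact: coord_continuous. Qed.

Lemma continuous_height : continuous (fun p : 'rV[R]_3 => sg * sol_s p).
Proof. by move=> p; exact: (cvgM (cvg_cst sg) (@continuous_sol_s p)). Qed.

Lemma continuous_hdist2 : continuous (@hdist2 R a b).
Proof.
move=> p; rewrite /continuous_at /hdist2 /hnorm2.
have cE : (fun q => expR (sol_s q)) @ p --> expR (sol_s p).
  by apply: cvg_comp; [exact: continuous_sol_s|exact: continuous_expR].
have cx i c : (fun q : 'rV[R]_3 => q 0 i - c) @ p --> p 0 i - c.
  have cc : (fun q : 'rV[R]_3 => q 0 i) @ p --> p 0 i by exact: coord_continuous.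
  exact: (cvgB cc (cvg_cst c)).
have c1 : (fun q : 'rV[R]_3 => expR (sol_s q) * (q 0 0 - a)) @ p --> expR (sol_s p) * (p 0 0 - a).
  exact: (cvgM cE (cx 0 a)).
have c2 : (fun q : 'rV[R]_3 => (q 0 1 - b) / expR (sol_s q)) @ p --> (p 0 1 - b) / expR (sol_s p).
  have En : expR (sol_s p) != 0 by rewrite gt_eqF ?expR_gt0.
  exact: (cvgM (cx 1 b) (cvgV En cE)).
exact: (cvgD (cvgM c1 c1) (cvgM c2 c2)).
Qed.

Lemma continuous_barrier p : 0 < hdist2 a b p -> {for p, continuous (barrier sg eta a b)}.
Proof.
move=> q0; rewrite /barrier /profile.
have c1 : (fun q : 'rV[R]_3 => - 2 * sg * sol_s q) @ p --> - 2 * sg * sol_s p.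
  have cs : (fun q => sol_s q) @ p --> sol_s p by exact: continuous_sol_s.
  exact: (cvgM (cvg_cst (- 2 * sg)) cs).
have c2 : (fun q => expR (- 2 * sg * sol_s q)) @ p --> expR (- 2 * sg * sol_s p).
  by apply: cvg_comp; [exact: c1|exact: continuous_expR].
have c3 : (fun q => ln (hdist2 a b q)) @ p --> ln (hdist2 a b p).
  by apply: cvg_comp; [exact: continuous_hdist2|exact: continuous_ln].
exact: (cvgD (cvgN c2) (cvgM (cvg_cst eta) c3)).
Qed.

End Continuity.

(** * The touching principle *)

(** If a and b span the plane orthogonal to N, the inverse first fundamental form
    of a and b, pushed forward to space, is the projection 1 - N^T N / |N|^2.
    Both sides are multiplied by the denominators. *)
Lemma tangent_trace (R : realFieldType) (a1 a2 a3 b1 b2 b3 N1 N2 N3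
    h11 h22 h33 h12 h13 h23 : R)
    (G00 := a1 ^+ 2 + a2 ^+ 2 + a3 ^+ 2)
    (G01 := a1 * b1 + a2 * b2 + a3 * b3)
    (G11 := b1 ^+ 2 + b2 ^+ 2 + b3 ^+ 2)
    (h := fun x1 x2 x3 y1 y2 y3 => h11 * x1 * y1 + h22 * x2 * y2 + h33 * x3 * y3
       + h12 * (x1 * y2 + x2 * y1) + h13 * (x1 * y3 + x3 * y1)
       + h23 * (x2 * y3 + x3 * y2)) :
  N1 * a1 + N2 * a2 + N3 * a3 = 0 -> N1 * b1 + N2 * b2 + N3 * b3 = 0 ->
  (N1 ^+ 2 + N2 ^+ 2 + N3 ^+ 2) *
    (G11 * h a1 a2 a3 a1 a2 a3 - 2 * G01 * h a1 a2 a3 b1 b2 b3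
       + G00 * h b1 b2 b3 b1 b2 b3)
  = (G00 * G11 - G01 ^+ 2) *
    ((N1 ^+ 2 + N2 ^+ 2 + N3 ^+ 2) * (h11 + h22 + h33) - h N1 N2 N3 N1 N2 N3).
Proof.
move=> Na Nb.
pose n1 := a2 * b3 - a3 * b2; pose n2 := a3 * b1 - a1 * b3.
pose n3 := a1 * b2 - a2 * b1.
pose D := n1 ^+ 2 + n2 ^+ 2 + n3 ^+ 2.
have DE : G00 * G11 - G01 ^+ 2 = D by rewrite /G00 /G11 /G01 /D /n1 /n2 /n3; ring.
pose NN := N1 ^+ 2 + N2 ^+ 2 + N3 ^+ 2.
have n12 : n1 * N2 = n2 * N1.
  transitivity (n2 * N1 + (b3 * (N1 * a1 + N2 * a2 + N3 * a3)
    - a3 * (N1 * b1 + N2 * b2 + N3 * b3))); first by rewrite /n1 /n2; ring.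
  by rewrite Na Nb; ring.
have n13 : n1 * N3 = n3 * N1.
  transitivity (n3 * N1 + (- b2 * (N1 * a1 + N2 * a2 + N3 * a3)
    + a2 * (N1 * b1 + N2 * b2 + N3 * b3))); first by rewrite /n1 /n3; ring.
  by rewrite Na Nb; ring.
have n23 : n2 * N3 = n3 * N2.
  transitivity (n3 * N2 + (b1 * (N1 * a1 + N2 * a2 + N3 * a3)
    - a1 * (N1 * b1 + N2 * b2 + N3 * b3))); first by rewrite /n2 /n3; ring.
  by rewrite Na Nb; ring.
(* N is proportional to the cross product n of a and b, hence so are the
   matrices N^T N and n^T n. *)
have par ni Ni nj Nj : n1 * Ni = ni * N1 -> n2 * Ni = ni * N2 ->
    n3 * Ni = ni * N3 -> n1 * Nj = nj * N1 -> n2 * Nj = nj * N2 ->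
    n3 * Nj = nj * N3 -> D * (Ni * Nj) = NN * (ni * nj).
  move=> i1 i2 i3 j1 j2 j3.
  transitivity ((n1 * Ni) * (n1 * Nj) + (n2 * Ni) * (n2 * Nj)
    + (n3 * Ni) * (n3 * Nj)); first by rewrite /D; ring.
  by rewrite i1 i2 i3 j1 j2 j3 /NN; ring.
have e11 : D * (N1 * N1) = NN * (n1 * n1) by apply: par.
have e22 : D * (N2 * N2) = NN * (n2 * n2) by apply: par.
have e33 : D * (N3 * N3) = NN * (n3 * n3) by apply: par.
have e12 : D * (N1 * N2) = NN * (n1 * n2) by apply: par.
have e13 : D * (N1 * N3) = NN * (n1 * n3) by apply: par.
have e23 : D * (N2 * N3) = NN * (n2 * n3) by apply: par.
rewrite -/NN DE.
transitivity (NN * (D * (h11 + h22 + h33) - h n1 n2 n3 n1 n2 n3)).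
  by rewrite /h /D /n1 /n2 /n3 /G00 /G01 /G11; ring.
have -> : D * (NN * (h11 + h22 + h33) - h N1 N2 N3 N1 N2 N3) =
  D * NN * (h11 + h22 + h33) - (h11 * (D * (N1 * N1)) + h22 * (D * (N2 * N2)) + h33 * (D * (N3 * N3))
   + 2 * h12 * (D * (N1 * N2)) + 2 * h13 * (D * (N1 * N3)) + 2 * h23 * (D * (N2 * N3))).
  by rewrite /h; ring.
rewrite e11 e22 e33 e12 e13 e23 /h; ring.
Qed.

(** The second derivative test for a function F on a minimal surface.  N and h are
    the gradient and Hessian of F, a and b span the tangent plane, and A, B, C
    are the components of the covariant Hessian of the surface; their trace is
    tangent, so it is annihilated by N and only the Hessian of F is left. *)
Lemma tangent_trace_ge0 (R : realFieldType) (a1 a2 a3 b1 b2 b3 N1 N2 N3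
    h11 h22 h33 h12 h13 h23 c0 c1 : R) (A00 A01 A10 A11 B00 B01 B10 B11
     C00 C01 C10 C11 : R)
    (G00 := a1 ^+ 2 + a2 ^+ 2 + a3 ^+ 2)
    (G01 := a1 * b1 + a2 * b2 + a3 * b3)
    (G11 := b1 ^+ 2 + b2 ^+ 2 + b3 ^+ 2)
    (quad := fun v0 v1 m00 m01 m10 m11 : R =>
       v0 * v0 * m00 + v0 * v1 * m01 + v1 * v0 * m10 + v1 * v1 * m11)
    (h := fun x1 x2 x3 => h11 * x1 ^+ 2 + h22 * x2 ^+ 2 + h33 * x3 ^+ 2
       + 2 * h12 * x1 * x2 + 2 * h13 * x1 * x3 + 2 * h23 * x2 * x3) :
  0 < G00 * G11 - G01 ^+ 2 ->
  G11 * A00 - G01 * A01 - G01 * A10 + G00 * A11 = c0 * a1 + c1 * b1 ->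
  G11 * B00 - G01 * B01 - G01 * B10 + G00 * B11 = c0 * a2 + c1 * b2 ->
  G11 * C00 - G01 * C01 - G01 * C10 + G00 * C11 = c0 * a3 + c1 * b3 ->
  N1 * a1 + N2 * a2 + N3 * a3 = 0 -> N1 * b1 + N2 * b2 + N3 * b3 = 0 ->
  (forall v0 v1, 0 <= N1 * quad v0 v1 A00 A01 A10 A11
      + N2 * quad v0 v1 B00 B01 B10 B11 + N3 * quad v0 v1 C00 C01 C10 C11
      + h (v0 * a1 + v1 * b1) (v0 * a2 + v1 * b2) (v0 * a3 + v1 * b3)) ->
  0 <= (N1 ^+ 2 + N2 ^+ 2 + N3 ^+ 2) * (h11 + h22 + h33) - h N1 N2 N3.
Proof.
move=> D0 HA HB HC Na Nb H.
have G00ge : 0 <= G00 by rewrite /G00 !addr_ge0 ?sqr_ge0.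
have G00n : G00 != 0.
  by apply/eqP => g0; move: D0; rewrite g0 mul0r sub0r oppr_gt0 ltNge sqr_ge0.
have G00p : 0 < G00 by rewrite lt_def G00n.
have := tangent_trace h11 h22 h33 h12 h13 h23 Na Nb.
rewrite -/G00 -/G01 -/G11.
set D := G00 * G11 - G01 ^+ 2 in D0 *.
set L := (X in _ * X = _); set M := (X in _ = D * X) => LM.
have L0 : 0 <= L.
  (* The directions (1, 0) and (- G01, G00) are orthogonal for the first
     fundamental form; the weights are those of its inverse. *)
  have := addr_ge0 (mulr_ge0 (ltW D0) (H 1 0)) (H (- G01) G00).
  rewrite [leRHS](_ : _ = G00 * L + G00 * (N1 * (G11 * A00 - G01 * A01 - G01 * A10 + G00 * A11)
    + N2 * (G11 * B00 - G01 * B01 - G01 * B10 + G00 * B11)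
    + N3 * (G11 * C00 - G01 * C01 - G01 * C10 + G00 * C11))); last first.
    rewrite /D /L /h /quad /=; move: G00 G01 G11 {L LM D D0 G00p G00n G00ge HA HB HC H M}.
    by move=> G00 G01 G11; ring.
  rewrite HA HB HC.
  rewrite (_ : N1 * _ + _ + _ = c0 * (N1 * a1 + N2 * a2 + N3 * a3) + c1 * (N1 * b1 + N2 * b2 + N3 * b3)); last by ring.
  by rewrite Na Nb !(mulr0, addr0) pmulr_rge0.
have : 0 <= D * M by rewrite -LM mulr_ge0// !addr_ge0 ?sqr_ge0.
rewrite pmulr_rge0// [in X in _ -> X](_ : _ - _ = M)// /M /h /=; ring.
Qed.

Lemma no_touching_pointwise (R : realType) (sg eta x y : R)
    (P p0 p1 H00 H01 H10 H11 : 'rV[R]_3) (c0 c1 : R)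
    (I := inner (@sol_metric R) P)
    (Gam := fun v w : 'rV[R]_3 => \row_k \sum_i \sum_j
      christoffel (@sol_metric R) k i j P * v 0 i * w 0 j)
    (quad := fun (v0 v1 : R) (k : 'I_3) =>
       v0 * (v0 * H00 0 k + v1 * H10 0 k) + v1 * (v0 * H01 0 k + v1 * H11 0 k))
    (lin := fun (v0 v1 : R) (k : 'I_3) => v0 * p0 0 k + v1 * p1 0 k) :
  0 < hnorm2 x y (sol_s P) -> sg ^+ 2 = 1 -> 0 < eta ->
  eta * (4 + 2 / hnorm2 x y (sol_s P)) < 2 * expR (- 2 * sg * sol_s P) ->
  0 < I p0 p0 * I p1 p1 - I p0 p1 ^+ 2 ->
  (forall k, I p1 p1 * (H00 + Gam p0 p0) 0 k - I p0 p1 * (H01 + Gam p0 p1) 0 k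
     - I p1 p0 * (H10 + Gam p1 p0) 0 k + I p0 p0 * (H11 + Gam p1 p1) 0 k
     = c0 * p0 0 k + c1 * p1 0 k) ->
  (forall v0 v1,
     dprofile sg eta x y (sol_s P) (lin v0 v1 0) (lin v0 v1 1) (lin v0 v1 ord_max) = 0
     /\ 0 <= ddprofile sg eta x y (sol_s P)
       (lin v0 v1 0) (lin v0 v1 1) (lin v0 v1 ord_max)
       (quad v0 v1 0) (quad v0 v1 1) (quad v0 v1 ord_max)) ->
  False.
Proof.
move=> q0 sg2 e0 small gram mini test.
have neg := barrier_trace_lt0 q0 sg2 e0 small.
have E0 : expR (sol_s P) != 0 by rewrite gt_eqF ?expR_gt0.
have m0 := mini 0; have m1 := mini 1; have m2 := mini ord_max; clear mini.
move: gram m0 m1 m2; rewrite /I !inner_sol.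
rewrite !mxE !sum_christoffel_sol /= => gram m0 m1 m2.
have g v0 v1 := etrans (esym (dprofile_frame sg eta q0 _ _ _)) (test v0 v1).1.
have h v0 v1 := etrans (congr1 (fun z => 0 <= z)
  (esym (ddprofile_frame sg eta q0 _ _ _ _ _ _))) (test v0 v1).2.
move: neg {test}; apply/negP; rewrite -leNgt.
move: g h; rewrite /lin /quad /= {Gam I lin quad}.
move: (grad1 _ _ _ _) (grad2 _ _ _ _) (grad3 _ _ _ _ _) (hess11 _ _ _ _ _)
  (hess22 _ _ _ _ _) (hess33 _ _ _ _ _) (hess12 _ _ _ _) (hess13 _ _ _ _)
  (hess23 _ _ _ _) => N1 N2 N3 h11 h22 h33 h12 h13 h23 g h.
move: (expR (sol_s P)) E0 gram m0 m1 m2 g h => E E0 gram m0 m1 m2 g h.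
apply: (tangent_trace_ge0 (c0 := c0) (c1 := c1)
  (A00 := E * (H00 0 0 + (p0 0 0 * p0 0 ord_max + p0 0 ord_max * p0 0 0)))
  (A01 := E * (H01 0 0 + (p0 0 0 * p1 0 ord_max + p0 0 ord_max * p1 0 0)))
  (A10 := E * (H10 0 0 + (p1 0 0 * p0 0 ord_max + p1 0 ord_max * p0 0 0)))
  (A11 := E * (H11 0 0 + (p1 0 0 * p1 0 ord_max + p1 0 ord_max * p1 0 0)))
  (B00 := (H00 0 1 - (p0 0 1 * p0 0 ord_max + p0 0 ord_max * p0 0 1)) / E)
  (B01 := (H01 0 1 - (p0 0 1 * p1 0 ord_max + p0 0 ord_max * p1 0 1)) / E)
  (B10 := (H10 0 1 - (p1 0 1 * p0 0 ord_max + p1 0 ord_max * p0 0 1)) / E)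
  (B11 := (H11 0 1 - (p1 0 1 * p1 0 ord_max + p1 0 ord_max * p1 0 1)) / E)
  (C00 := H00 0 ord_max + (- E ^+ 2 * p0 0 0 * p0 0 0 + E ^- 2 * p0 0 1 * p0 0 1))
  (C01 := H01 0 ord_max + (- E ^+ 2 * p0 0 0 * p1 0 0 + E ^- 2 * p0 0 1 * p1 0 1))
  (C10 := H10 0 ord_max + (- E ^+ 2 * p1 0 0 * p0 0 0 + E ^- 2 * p1 0 1 * p0 0 1))
  (C11 := H11 0 ord_max + (- E ^+ 2 * p1 0 0 * p1 0 0 + E ^- 2 * p1 0 1 * p1 0 1))
  (a1 := E * p0 0 0) (a2 := p0 0 1 / E) (a3 := p0 0 ord_max)
  (b1 := E * p1 0 0) (b2 := p1 0 1 / E) (b3 := p1 0 ord_max)).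
- by rewrite -!expr2 in gram.
- rewrite -!expr2 in m0; transitivity (E * (c0 * p0 0 0 + c1 * p1 0 0)); last by ring.
  by rewrite -m0; ring.
- rewrite -!expr2 in m1; transitivity ((c0 * p0 0 1 + c1 * p1 0 1) / E); last by field.
  by rewrite -m1; field.
- by rewrite -m2; ring.
- by rewrite -(g 1 0); ring.
- by rewrite -(g 0 1); ring.
- move=> v0 v1; apply: le_trans (h v0 v1) _; rewrite le_eqVlt; apply/orP; left; apply/eqP.
  by field.
Qed.

(** The touching principle.  At a local minimum, the derivative tests along the
    lines through u give the hypotheses of [tangent_trace_ge0], whose conclusion
    contradicts [barrier_trace_lt0]. *)
Lemma no_interior_min (R : realType) (sg eta a b : R) (U : set 'rV[R]_2)
    (X : 'rV[R]_2 -> 'rV[R]_3) (u : 'rV[R]_2) :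
  open U -> smooth_on U X -> U u -> injective ('d X u) ->
  mean_curvature_vector (@sol_metric R) X u = 0 ->
  0 < hdist2 a b (X u) -> sg ^+ 2 = 1 -> 0 < eta ->
  eta * (4 + 2 / hdist2 a b (X u)) < 2 * expR (- 2 * sg * sol_s (X u)) ->
  ~ \forall v \near u, barrier sg eta a b (X u) <= barrier sg eta a b (X v).
Proof.
move=> Uo sX Uu inj minX q0 sg2 e0 small umin.
have dX := smooth_differentiable sX Uu.
have gram := sol_gram_gt0 (X u) (immersion_free dX inj).
have [c minc] := minimal_trace (sol_gram_neq0 (X u) (immersion_free dX inj)) minX.
apply: (no_touching_pointwise q0 sg2 e0 small gram minc) => v0 v1.
pose v : 'rV[R]_2 := \row_i (if i == 0 then v0 else v1).
have [v0E v1E] : v 0 0 = v0 /\ v 0 1 = v1 by rewrite !mxE.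
have nU : nbhs u [set w | [/\ U w, 0 < hdist2 a b (X w) &
    barrier sg eta a b (X u) <= barrier sg eta a b (X w)]].
  have cq : (hdist2 a b \o X) @ u --> hdist2 a b (X u).
    by apply: cvg_comp; [exact: differentiable_continuous dX|exact: continuous_hdist2].
  have nq : \forall w \near u, 0 < hdist2 a b (X w) by exact: cvgr_gt cq _ q0.
  have nU' : \forall w \near u, U w by exact: open_nbhs_nbhs.
  by apply: filterS3 nU' nq umin => w; split.
have [r r0 rP] := near_line v nU.
have d1 k t : `|t| < r -> der t (fun t => X (u + t *: v) 0 k) (line_velocity X u v k t).
  by move=> /rP[Ut _ _]; exact: (der_line sX).
have d2 k : der 0 (line_velocity X u v k) (line_acceleration X u v k) by apply: der_line_velocity; [exact: sX|exact: Uu].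
have u0 : u + 0 *: v = u by rewrite scale0r addr0.
have r00 : `|0 : R| < r by rewrite normr0.
have q00 : 0 < hnorm2 (X (u + 0 *: v) 0 0 - a) (X (u + 0 *: v) 0 1 - b) (X (u + 0 *: v) 0 ord_max).
  by rewrite u0.
have [f0 f1] := second_derivative_test
  (f := fun t => barrier sg eta a b (X (u + t *: v)))
  (f' := fun t => dprofile sg eta (X (u + t *: v) 0 0 - a) (X (u + t *: v) 0 1 - b)
    (X (u + t *: v) 0 ord_max) (line_velocity X u v 0 t) (line_velocity X u v 1 t) (line_velocity X u v ord_max t))
  r0
  (fun t tr => der_profile (der_shift a (d1 0 t tr)) (der_shift b (d1 1 t tr)) (d1 ord_max t tr) sg eta
     (let: And3 _ q _ := rP t tr in q))
  (der_dprofile (der_shift a (d1 0 0 r00)) (der_shift b (d1 1 0 r00)) (d1 ord_max 0 r00)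
     (d2 0) (d2 1) (d2 ord_max) sg eta q00)
  (fun t tr => let: And3 _ _ m := rP t tr in
     eq_ind_r (fun z => barrier sg eta a b (X z) <= _) m u0).
move: f0 f1; rewrite /line_velocity /line_acceleration u0 v0E v1E => f0 f1.
by split; [exact: f0|exact: f1].
Qed.

(** * Compactness *)

Lemma continuous_dist (R : realType) n (u : 'rV[R]_n) :
  continuous (fun v : 'rV[R]_n => `|v - u|).
Proof.
move=> v.
have FF : Filter (nbhs v) := nbhs_filter v.
apply/(@cvgrPdist_lt _ _ _ _ FF) => e e0.
apply/nbhs_ballP; exists e => //= w; rewrite -ball_normE /= => vw.
apply: le_lt_trans vw; rewrite (le_trans (ler_dist_dist _ _))//.
by rewrite opprB addrA subrK.
Qed.

Lemma compact_cball (R : realType) n (u : 'rV[R]_n) (r : R) :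
  compact [set v | `|v - u| <= r].
Proof.
apply: bounded_closed_compact.
  exists (`|u| + r); split; first exact: num_real.
  move=> M uM v /= vr; rewrite -(subrK u v).
  by rewrite (le_trans (ler_normD _ _))//; lra.
exact: (closed_comp (fun v _ => @continuous_dist R n u v) (@closed_le R r)).
Qed.

Lemma compact_sphere (R : realType) n (u : 'rV[R]_n) (r : R) :
  compact [set v | `|v - u| = r].
Proof.
have -> : [set v | `|v - u| = r] = [set v | `|v - u| <= r] `&` [set v | r <= `|v - u|].
  apply/seteqP; split => v /=; first by move=> ->.
  by move=> [h1 h2]; apply/eqP; rewrite eq_le h1.
apply: compact_closedI; first exact: compact_cball.
exact: (closed_comp (fun v _ => @continuous_dist R n u v) (@closed_ge R r)).
Qed.

Lemma near_cball (R : realType) m (P : set 'rV[R]_m) (u : 'rV[R]_m) :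
  nbhs u P -> exists2 r : R, 0 < r & forall v, `|v - u| <= r -> P v.
Proof.
move=> /nbhs_ballP[e /= e0 eP]; exists (e / 2); first by rewrite divr_gt0.
move=> v vu; apply: eP; rewrite -ball_normE /= distrC.
by apply: le_lt_trans vu _; rewrite ltr_pdivrMr// ltr_pMr// ltr1n.
Qed.

Lemma near_dist_lt (R : realType) m (u : 'rV[R]_m) (r : R) : 0 < r ->
  \forall v \near u, `|v - u| < r.
Proof.
move=> r0; apply/nbhs_ballP; exists r => //= v; rewrite -ball_normE /=.
by rewrite distrC.
Qed.

Lemma compact_min (T : topologicalType) (R : realType) (K : set T) (g : T -> R) :
  K !=set0 -> compact K -> (forall x, K x -> {for x, continuous g}) ->
  exists2 c, K c & forall x, K x -> g c <= g x.
Proof.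
move=> K0 cK cg.
have cw : {within K, continuous g}.
  by apply: continuous_in_subspaceT => x; rewrite inE; exact: cg.
have [c cc cm] := compact_EVT_min K0 cK cw.
by exists c => [|x Kx]; [rewrite inE in cc|apply: cm; rewrite inE].
Qed.

Lemma compact_lb (T : topologicalType) (R : realType) (K : set T) (g : T -> R) :
  compact K -> (forall x, K x -> {for x, continuous g}) ->
  exists m, forall x, K x -> m <= g x.
Proof.
move=> cK cg; have [K0|/set0P/negP/negPn/eqP K0] := pselect (K !=set0).
  by have [c cc cm] := compact_min K0 cK cg; exists (g c).
by exists 1 => // x; rewrite K0.
Qed.

Lemma compact_pos_lb (T : topologicalType) (R : realType) (K : set T) (g : T -> R) :
  compact K -> (forall x, K x -> {for x, continuous g}) -> (forall x, K x -> 0 < g x) ->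
  exists2 m, 0 < m & forall x, K x -> m <= g x.
Proof.
move=> cK cg pos; have [K0|/set0P/negP/negPn/eqP K0] := pselect (K !=set0).
  by have [c cc cm] := compact_min K0 cK cg; exists (g c) => //; exact: pos.
by exists 1 => // x; rewrite K0.
Qed.

(** The function is continuous at the points of K only, so its level set need not
    be closed; a cluster point in K is still in the level set. *)
Lemma compact_level (T : topologicalType) (R : realType) (K : set T) (g : T -> R) (c : R) :
  compact K -> (forall x, K x -> {for x, continuous g}) ->
  compact (K `&` [set x | g x = c]).
Proof.
move=> cK cg F PF FKZ.
have FK : F K by move: FKZ; apply: filterS => x [].
have [x [Kx clx]] := cK F PF FK.
exists x; split => //; split => //=; apply: contrapT => gx.
have nb : nbhs x [set y | g y != c].
  have c' : (fun y => g y - c) @ x --> g x - c by exact: (cvgB (cg x Kx) (cvg_cst c)).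
  have gxc : g x - c != 0 by rewrite subr_eq0; apply/eqP.
  have n : \forall y \near x, g y - c != 0 by exact: (cvgr_neq0 _ c' gxc).
  by apply: filterS n => y; rewrite subr_eq0.
have [y [[_ /= ->]]] := clx _ _ FKZ nb.
by rewrite eqxx.
Qed.

(** If e is small, the term e * L cannot compensate A where A is bounded below,
    and elsewhere L is bounded below by compactness. *)
Lemma compact_perturbation (T : topologicalType) (R : realType) (K : set T) (A L : T -> R) :
  compact K -> (forall x, K x -> {for x, continuous A}) ->
  (forall x, K x -> {for x, continuous L}) ->
  (forall x, K x -> 0 <= A x) -> (forall x, K x -> A x = 0 -> 0 < L x) ->
  exists2 e0, 0 < e0 & forall e, 0 < e -> e < e0 -> forall x, K x -> 0 < A x + e * L x.
Proof.
move=> cK cA cL A0 L0.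
(* Twice the maximum of A and L, which is positive on K. *)
pose G x := A x + L x + `|A x - L x|.
have G0 x : K x -> 0 < G x.
  move=> Kx; rewrite /G; have [AL|LA] := leP (A x) (L x); last first.
    have Ap : 0 < A x.
      by rewrite lt_def A0// andbT; apply/eqP => Ax; have := L0 x Kx Ax; lra.
    by rewrite gtr0_norm ?subr_gt0//; lra.
  rewrite ler0_norm ?subr_le0//.
  have [Ax|An] := eqVneq (A x) 0; first by have := L0 x Kx Ax; lra.
  by have : 0 < A x; [rewrite lt_def An A0|lra].
have [m m0 mG] : exists2 m, 0 < m & forall x, K x -> m <= G x.
  apply: compact_pos_lb => // x Kx.
  apply: cvgD; first by apply: cvgD; [exact: cA|exact: cL].
  by apply: cvg_norm; apply: cvgB; [exact: cA|exact: cL].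
have [l lL] := compact_lb cK cL.
have l0 : 0 < 2 * (`|l| + 1) by rewrite mulr_gt0// ltr_wpDl.
exists (m / (2 * (`|l| + 1))); first by rewrite divr_gt0.
move=> e e0 el x Kx; have := mG x Kx; rewrite /G.
have el' : e * `|l| < m / 2.
  rewrite ltr_pdivlMr// in el; lra.
have le : - (e * `|l|) <= e * L x.
  rewrite -mulrN ler_pM2l//; have := lL x Kx; have := ler_norm (- l); rewrite normrN; lra.
have [AL|LA] := leP (A x) (L x); last by rewrite gtr0_norm ?subr_gt0//; lra.
rewrite ler0_norm ?subr_le0// => h.
have : 0 < e * L x by rewrite mulr_gt0//; lra.
by have := A0 x Kx; lra.
Qed.

Lemma exists_small_factor (R : realType) (e0 c d : R) : 0 < e0 -> 0 < c -> 0 < d ->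
  exists e, [/\ 0 < e, e < e0 & e * c < d].
Proof.
move=> h0 h1 h2; pose m := Num.min e0 (d / c).
have m0 : 0 < m by rewrite lt_min h0 divr_gt0.
have [me md] : m <= e0 /\ m <= d / c by rewrite !ge_min !lexx orbT.
exists (m / 2); split; [lra|lra|].
by rewrite ler_pdivlMr// in md; have := mulr_gt0 m0 h1; lra.
Qed.

(** * Contact with a special plane *)

Lemma continuous_coord_at (R : realType) m n (F : 'rV[R]_m -> 'rV[R]_n) (u : 'rV[R]_m) (k : 'I_n) :
  differentiable F u -> {for u, continuous (fun v => F v 0 k)}.
Proof.
move=> dF.
have cF : F @ u --> F u by exact: differentiable_continuous dF.
have cc : (fun M : 'rV[R]_n => M 0 k) @ F u --> F u 0 k by exact: coord_continuous.
exact: (cvg_comp _ _ cF cc).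
Qed.

(** The mean value theorem on the segment from v to u, for each horizontal
    component separately. *)
Lemma local_injectivity (R : realType) (U : set 'rV[R]_2) (X : 'rV[R]_2 -> 'rV[R]_3)
    (u0 : 'rV[R]_2) :
  open U -> smooth_on U X -> U u0 ->
  partial 0 X u0 0 0 * partial 1 X u0 0 1 - partial 1 X u0 0 0 * partial 0 X u0 0 1 != 0 ->
  exists2 r : R, 0 < r & (forall v, `|v - u0| <= r -> U v) /\
    forall u v, `|u - u0| <= r -> `|v - u0| <= r ->
      X u 0 0 = X v 0 0 -> X u 0 1 = X v 0 1 -> u = v.
Proof.
move=> Uo sX Uu d0.
have FF : Filter (nbhs u0) := nbhs_filter u0.
have cp a k : (fun u => partial a X u 0 k) @ u0 --> partial a X u0 0 k.
  have [_ dp] := sX 2%N; have [dpa _] := dp a.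
  exact: continuous_coord_at (dpa _ Uu).
(* The two components are differentiated at two different points of the
   segment, so the determinant must be nonzero for any pair of points. *)
pose D (z : 'rV[R]_2 * 'rV[R]_2) := partial 0 X z.1 0 0 * partial 1 X z.2 0 1
   - partial 1 X z.1 0 0 * partial 0 X z.2 0 1.
have cD : D @ (u0, u0) --> D (u0, u0).
  have c1 a k : (fun z : 'rV[R]_2 * 'rV[R]_2 => partial a X z.1 0 k)
      @ (u0, u0) --> partial a X u0 0 k.
    have cf : (@fst 'rV[R]_2 'rV[R]_2) @ (u0, u0) --> u0 by exact: cvg_fst.
    exact: (cvg_comp _ _ cf (cp a k)).
  have c2 a k : (fun z : 'rV[R]_2 * 'rV[R]_2 => partial a X z.2 0 k)
      @ (u0, u0) --> partial a X u0 0 k.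
    have cf : (@snd 'rV[R]_2 'rV[R]_2) @ (u0, u0) --> u0 by exact: cvg_snd.
    exact: (cvg_comp _ _ cf (cp a k)).
  exact: (cvgB (cvgM (c1 0 0) (c2 1 1)) (cvgM (c1 1 0) (c2 0 1))).
have nD : \forall z \near (u0, u0), D z != 0 by exact: cvgr_neq0 cD d0.
have [[A B] [/= nA nB] AB] := nD.
have nU : nbhs u0 U by exact: open_nbhs_nbhs.
have [r r0 rP] := near_cball (filterI nU (filterI nA nB)).
exists r => //; split=> [v /rP[]//|u v ur vr e0 e1].
pose w := u - v.
have conv (t : R) : 0 <= t -> t <= 1 -> `|v + t *: w - u0| <= r.
  move=> t0 t1; have -> : v + t *: w - u0 = (1 - t) *: (v - u0) + t *: (u - u0).
    by rewrite /w; apply/rowP => i; rewrite !mxE; ring.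
  rewrite (le_trans (ler_normD _ _))// !normrZ !ger0_norm ?subr_ge0//.
  have -> : r = (1 - t) * r + t * r by ring.
  by rewrite lerD// ler_wpM2l// subr_ge0.
have vw : v + w = u by rewrite /w addrC subrK.
have mv k : X u 0 k = X v 0 k -> exists2 x, `|x - u0| <= r &
    w 0 0 * partial 0 X x 0 k + w 0 1 * partial 1 X x 0 k = 0.
  move=> ek; pose g (t : R) := X (v + t *: w) 0 k.
  have dg (t : R) : t \in `[0, 1] -> is_derive t 1 g (line_velocity X v w k t).
    rewrite in_itv /= => /andP[t0 t1].
    have [Ut _] := rP _ (conv t t0 t1).
    exact: (der_line sX).
  have gc : {within `[0, 1], continuous g}.
    by apply: derivable_within_continuous => t t01; have [] := dg t t01.
  have dgo (t : R) : t \in `]0, 1[ -> is_derive t 1 g (line_velocity X v w k t).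
    by move=> t01; apply: dg; rewrite in_itv /= !ltW// (itvP t01).
  have [t t01 ge] := MVT ltr01 dgo gc.
  exists (v + t *: w); first by apply: conv; rewrite ltW// (itvP t01).
  move: ge; rewrite /g scale1r scale0r addr0 vw ek subrr subr0 mulr1.
  by move=> /esym.
have [x xr xe] := mv 0 e0; have [y yr ye] := mv 1 e1.
have Dxy : D (x, y) != 0.
  have [_ [Ax _]] := rP x xr; have [_ [_ By]] := rP y yr.
  exact: (AB (x, y)).
have Dxy' : partial 0 X x 0 0 * partial 1 X y 0 1
    - partial 1 X x 0 0 * partial 0 X y 0 1 != 0 by [].
have [w0 w1] := det2_ker0 Dxy' xe ye.
apply/eqP; rewrite -subr_eq0 -/w; apply/eqP/rowP => i; rewrite [RHS]mxE.
by have [->|->] := ord2P i.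
Qed.

Definition minimal_on (R : realType) (U : set 'rV[R]_2) (X : 'rV[R]_2 -> 'rV[R]_3) :=
  [/\ open U, smooth_on U X, forall u, U u -> injective ('d X u) &
      forall u, U u -> mean_curvature_vector (@sol_metric R) X u = 0].

Lemma critical_height (R : realType) (U : set 'rV[R]_2) (X : 'rV[R]_2 -> 'rV[R]_3)
    (u : 'rV[R]_2) (sg : R) : sg ^+ 2 = 1 ->
  open U -> smooth_on U X -> U u ->
  (\forall v \near u, sg * sol_s (X u) <= sg * sol_s (X v)) ->
  forall a, partial a X u 0 ord_max = 0.
Proof.
move=> sg2 Uo sX Uu umin a.
have FF : Filter (nbhs u) := nbhs_filter u.
have nU : nbhs u U by exact: open_nbhs_nbhs.
have [r r0 rP] := near_line (delta_mx 0 a) (filterI nU umin).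
have d t : `|t| < r -> der t (fun t => sg * X (u + t *: delta_mx 0 a) 0 ord_max)
    (sg * line_velocity X u (delta_mx 0 a) ord_max t).
  by move=> /rP[Ut _]; apply: der_scale; exact: (der_line sX).
have hm (t : R) : `|t| < r -> sg * X (u + 0 *: delta_mx 0 a) 0 ord_max <=
    sg * X (u + t *: delta_mx 0 a) 0 ord_max.
  by move=> /rP[_ /=]; rewrite scale0r addr0.
have := first_derivative_test r0 d hm.
rewrite line_velocity_delta.
have sg0 : sg != 0 by rewrite -sqrf_eq0 sg2 oner_eq0.
by move=> /eqP; rewrite mulf_eq0 (negbTE sg0) => /eqP.
Qed.

Lemma hnorm2_gt0 (R : realType) (x y s : R) : (x != 0) || (y != 0) -> 0 < hnorm2 x y s.
Proof.
move=> xy; have E0 := expR_gt0 s.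
rewrite lt_def /hnorm2 addr_ge0 ?sqr_ge0// andbT paddr_eq0 ?sqr_ge0//.
by rewrite !expf_eq0 /= !mulf_eq0 invr_eq0 gt_eqF//= orbF negb_and.
Qed.

Lemma hnorm2_ge0 (R : realType) (x y s : R) : 0 <= hnorm2 x y s.
Proof. by rewrite /hnorm2 addr_ge0 ?sqr_ge0. Qed.

(** Near z the contact set meets the closed horizontal disc around (a, b) through
    z in the point z only.  On a small sphere around z the barrier is then
    larger than at z: on the contact set because of its logarithmic term, and
    elsewhere because of the height, for small eta.  So the barrier has an
    interior minimum. *)
Lemma no_touching_disc (R : realType) (sg m0 a b r : R) (U : set 'rV[R]_2)
    (X : 'rV[R]_2 -> 'rV[R]_3) (z : 'rV[R]_2) :
  minimal_on U X -> sg ^+ 2 = 1 ->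
  0 < r -> (forall v, `|v - z| <= r -> U v) ->
  (forall v, U v -> m0 <= sg * sol_s (X v)) -> sg * sol_s (X z) = m0 ->
  0 < hdist2 a b (X z) ->
  (forall v, `|v - z| <= r -> sg * sol_s (X v) = m0 -> v != z ->
     hdist2 a b (X z) < hdist2 a b (X v)) ->
  False.
Proof.
move=> [Uo sX injX minX] sg2 r0 rU wm zm q0 qz.
set rho := hdist2 a b (X z) in q0 qz.
have FF : Filter (nbhs z) := nbhs_filter z.
have Uz : U z by apply: rU; rewrite subrr normr0 ltW.
have cX v : U v -> X @ v --> X v.
  by move=> Uv; apply: differentiable_continuous; exact: (smooth_differentiable sX).
have cq v : U v -> {for v, continuous (fun v => hdist2 a b (X v))}.
  by move=> Uv; apply: cvg_comp; [exact: cX|exact: continuous_hdist2].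
have cs v : U v -> {for v, continuous (fun v => sg * sol_s (X v))}.
  by move=> Uv; exact: (cvg_comp _ _ (cX v Uv) (@continuous_height R sg (X v))).
have nq : \forall v \near z, rho / 2 < hdist2 a b (X v).
  have c : (fun v => hdist2 a b (X v)) @ z --> rho by exact: cq.
  by apply: (cvgr_gt _ c); clear -q0; lra.
have ns : \forall v \near z, sg * sol_s (X v) < m0 + 1.
  have c : (fun v => sg * sol_s (X v)) @ z --> m0 by rewrite -zm; exact: cs.
  by apply: (cvgr_lt _ c); rewrite ltrDl.
have nr := near_dist_lt z r0.
have [r2 r20 r2P] := near_cball (filterI nq (filterI ns nr)).
have r2U v : `|v - z| <= r2 -> U v by move=> /r2P[_ [_ /ltW]]; exact: rU.
(* F - F z = A + e * L on the ball: the height contributes A >= 0, and L > 0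
   where A vanishes on the boundary sphere. *)
pose A v := - expR (- 2 * (sg * sol_s (X v))) + expR (- 2 * m0).
pose L v := ln (hdist2 a b (X v)) - ln rho.
have qpos v : `|v - z| <= r2 -> 0 < hdist2 a b (X v).
  by move=> /r2P[/= + _]; lra.
have cA v : U v -> {for v, continuous A}.
  move=> Uv.
  have c1 : (fun v => - 2 * (sg * sol_s (X v))) @ v --> - 2 * (sg * sol_s (X v)).
    exact: (cvgM (cvg_cst (- 2 : R)) (cs v Uv)).
  have c2 : (fun v => expR (- 2 * (sg * sol_s (X v)))) @ v --> expR (- 2 * (sg * sol_s (X v))).
    by apply: cvg_comp; [exact: c1|exact: continuous_expR].
  exact: (cvgD (cvgN c2) (cvg_cst _)).
have cL v : `|v - z| <= r2 -> {for v, continuous L}.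
  move=> vz.
  have c1 : (fun v => ln (hdist2 a b (X v))) @ v --> ln (hdist2 a b (X v)).
    by apply: cvg_comp; [exact: cq (r2U v vz)|exact: continuous_ln (qpos v vz)].
  exact: (cvgB c1 (cvg_cst _)).
have A0 v : U v -> 0 <= A v.
  by move=> Uv; rewrite /A addrC subr_ge0 ler_expR ler_nM2l ?wm//; lra.
have AL v : `|v - z| = r2 -> A v = 0 -> 0 < L v.
  move=> vz Av0; have vr2 : `|v - z| <= r2 by rewrite vz.
  have /expR_inj e1 : expR (- 2 * (sg * sol_s (X v))) = expR (- 2 * m0).
    by move: Av0; rewrite /A; lra.
  have wv : sg * sol_s (X v) = m0 by lra.
  have vr : `|v - z| <= r by rewrite ltW//; have [_ [_ ]] := r2P v vr2.
  have vzn : v != z.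
    by apply: contraTneq r20 => vE; rewrite -vz vE subrr normr0 ltxx.
  by rewrite /L subr_gt0 ltr_ln ?posrE ?(qpos v)//; exact: (qz v vr wv vzn).
have [e0 e00 e0P] : exists2 e0, 0 < e0 & forall e, 0 < e -> e < e0 ->
    forall v, `|v - z| = r2 -> 0 < A v + e * L v.
  apply: compact_perturbation; first exact: compact_sphere.
  - by move=> v /= vz; apply: cA; apply: r2U; rewrite vz.
  - by move=> v /= vz; apply: cL; rewrite vz.
  - by move=> v /= vz; apply: A0; apply: r2U; rewrite vz.
  - exact: AL.
have [e [ep ee0 esmall]] : exists e, [/\ 0 < e, e < e0 &
    e * (4 + 4 / rho) < 2 * expR (- 2 * (m0 + 1))].
  by apply: exists_small_factor => //; rewrite ?mulr_gt0 ?expR_gt0// addr_gt0// divr_gt0.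
pose F v := barrier sg e a b (X v).
have FE v : F v - F z = A v + e * L v.
  rewrite /F /barrier /profile -/(hdist2 a b (X v)) -/(hdist2 a b (X z)) -/rho /A /L.
  by rewrite -!mulrA zm; ring.
have K0 : [set v | `|v - z| <= r2] !=set0 by exists z; rewrite /= subrr normr0 ltW.
have cF v : `|v - z| <= r2 -> {for v, continuous F}.
  move=> vz; have c := @continuous_barrier R sg e a b (X v) (qpos v vz).
  by apply: cvg_comp; [exact: cX (r2U v vz)|exact: c].
have [u uz umin] := compact_min K0 (@compact_cball R 2 z r2) cF.
have Fuz : F u <= F z by apply: umin; rewrite /= subrr normr0 ltW.
have ult : `|u - z| < r2.
  rewrite lt_def uz andbT; apply: contraTneq Fuz => /esym ur.
  by rewrite -ltNge -subr_gt0 FE; apply: e0P.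
have [/= qu [su _]] := r2P u uz.
apply: (@no_interior_min R sg e a b U X u Uo sX (r2U u uz) (injX u (r2U u uz))
  (minX u (r2U u uz)) (qpos u uz) sg2 ep).
- have h1 : e * (4 + 2 / hdist2 a b (X u)) <= e * (4 + 4 / rho).
    rewrite ler_pM2l// lerD2l ler_pdivrMr ?qpos// mulrAC ler_pdivlMr//; lra.
  have h2 : expR (- 2 * (m0 + 1)) <= expR (- 2 * sg * sol_s (X u)).
    by rewrite ler_expR -mulrA ler_nM2l ?ltW//; lra.
  by lra.
- apply/nbhs_ballP; exists (r2 - `|u - z|); first by rewrite /= subr_gt0.
  move=> v; rewrite -ball_normE /= => uv; apply: umin => /=.
  have := ler_distD u v z; rewrite (distrC v u); move: uv; clear; lra.
Qed.

(** The interior ball argument of Hopf.  If the contact set is not a neighbourhood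
    of u0, take u1 close to u0 outside it, and a contact point z that is
    horizontally nearest to u1.  Halving the disc around u1 through z makes z
    its only contact point. *)
Lemma contact_set_open (R : realType) (sg m0 : R) (U : set 'rV[R]_2)
    (X : 'rV[R]_2 -> 'rV[R]_3) (u0 : 'rV[R]_2) :
  minimal_on U X -> sg ^+ 2 = 1 ->
  (forall v, U v -> m0 <= sg * sol_s (X v)) -> U u0 -> sg * sol_s (X u0) = m0 ->
  \forall v \near u0, sg * sol_s (X v) = m0.
Proof.
move=> mX sg2 wm Uu wu; have [Uo sX injX minX] := mX.
have FF : Filter (nbhs u0) := nbhs_filter u0.
have nU : nbhs u0 U by exact: open_nbhs_nbhs.
have crit : forall a, partial a X u0 0 ord_max = 0.
  apply: (critical_height sg2 Uo sX Uu).
  by apply: filterS nU => v Uv; rewrite wu; exact: wm.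
have dX v : U v -> differentiable X v by exact: smooth_differentiable.
have det := horizontal_det_neq0 (immersion_free (dX _ Uu) (injX _ Uu)) (crit 0) (crit 1).
have [r r0 [rU inj]] := local_injectivity Uo sX Uu det.
pose s0 := sg * m0.
have sE v : sg * sol_s (X v) = m0 -> sol_s (X v) = s0.
  by move=> wv; rewrite /s0 -wv mulrA -expr2 sg2 mul1r.
(* Squared horizontal distance at the height of the contact set. *)
pose Q u v := hnorm2 (X u 0 0 - X v 0 0) (X u 0 1 - X v 0 1) s0.
have QC u v : Q u v = Q v u by rewrite /Q /hnorm2; ring.
have Qpos u v : `|u - u0| <= r -> `|v - u0| <= r -> u != v -> 0 < Q u v.
  move=> ur vr uv; apply: hnorm2_gt0; apply: contraNT uv.
  rewrite negb_or !negbK !subr_eq0 => /andP[/eqP e0 /eqP e1].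
  by apply/eqP; exact: inj.
have Qtri u v w : Q u w <= 2 * Q u v + 2 * Q v w.
  rewrite -subr_ge0 /Q /hnorm2.
  set E := expR s0; rewrite [leRHS](_ : _ =
   (E * ((X u 0 0 - X v 0 0) - (X v 0 0 - X w 0 0))) ^+ 2 +
   (((X u 0 1 - X v 0 1) - (X v 0 1 - X w 0 1)) / E) ^+ 2); last by ring.
  by rewrite addr_ge0 ?sqr_ge0.
have cQ v w : U v -> {for v, continuous (fun v => Q v w)}.
  move=> Uv; have c0 := continuous_coord_at (k := 0) (dX v Uv).
  have c1 := continuous_coord_at (k := 1) (dX v Uv).
  have d0 : (fun v => expR s0 * (X v 0 0 - X w 0 0)) @ v --> expR s0 * (X v 0 0 - X w 0 0).
    exact: (cvgM (cvg_cst _) (cvgB c0 (cvg_cst _))).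
  have d1 : (fun v => (X v 0 1 - X w 0 1) / expR s0) @ v --> (X v 0 1 - X w 0 1) / expR s0.
    exact: (cvgM (cvgB c1 (cvg_cst _)) (cvg_cst _)).
  exact: (cvgD (cvgM d0 d0) (cvgM d1 d1)).
have cs v : U v -> {for v, continuous (fun v => sg * sol_s (X v))}.
  move=> Uv; have c2 := continuous_coord_at (k := ord_max) (dX v Uv).
  exact: (cvgM (cvg_cst sg) c2).
have [mu mu0 muP] : exists2 mu, 0 < mu & forall v, `|v - u0| = r -> mu <= Q v u0.
  apply: compact_pos_lb; first exact: compact_sphere.
    by move=> v /= vr; apply: cQ; apply: rU; rewrite vr.
  move=> v /= vr; have vu : v != u0.
    by apply/eqP => vE; move: r0; rewrite -vr vE subrr normr0 ltxx.
  by apply: Qpos => //; rewrite ?vr// subrr normr0 ltW.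
have [//|nZ] := pselect (\forall v \near u0, sg * sol_s (X v) = m0).
have nQ : \forall v \near u0, Q v u0 < mu / 4.
  have c : (fun v => Q v u0) @ u0 --> 0.
    have := cQ u0 u0 Uu; rewrite /prop_for /continuous_at.
    by rewrite [X in _ --> X](_ : _ = 0) // /Q /hnorm2 !subrr mulr0 mul0r expr0n addr0.
  by apply: (cvgr_lt _ c); rewrite divr_gt0.
have nr := near_dist_lt u0 r0.
(* Outside the contact set, and so close to u0 that the contact points nearest
   to u1 are inside the sphere of radius r. *)
have [u1 [u1Q [u1r u1Z]]] : exists u1, [/\ Q u1 u0 < mu / 4, `|u1 - u0| <= r &
    sg * sol_s (X u1) <> m0].
  apply: contrapT => no; apply: nZ.
  apply: filterS (filterI nQ nr) => v [vQ vr].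
  by apply: contrapT => vZ; apply: no; exists v; split => //; exact: ltW.
pose K := [set v | `|v - u0| <= r] `&` [set v | sg * sol_s (X v) = m0].
have K0 : K !=set0 by exists u0; split => //=; rewrite subrr normr0 ltW.
have cK : compact K.
  by apply: compact_level; [exact: compact_cball|move=> v /rU; exact: cs].
have cQK v : K v -> {for v, continuous (fun v => Q v u1)}.
  by move=> [/rU Uv _]; exact: cQ.
have [z [/= zr zZ] zmin] := compact_min K0 cK cQK.
have zu0 : Q z u1 <= Q u0 u1 by apply: zmin; split => //=; rewrite subrr normr0 ltW.
have zlt : `|z - u0| < r.
  rewrite lt_def zr andbT eq_sym; apply/eqP => zeq.
  have := muP z zeq; have := Qtri z u1 u0; move: zu0 u1Q mu0; rewrite (QC u0 u1).
  by clear; lra.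
have zu1 : 0 < Q z u1.
  by apply: Qpos => //; apply/eqP => zE; apply: u1Z; rewrite -zE.
(* The disc with diameter from z to u1 touches the disc around u1 through z
   from inside at z, so it meets the contact set at z only. *)
pose a := (X z 0 0 + X u1 0 0) / 2; pose b := (X z 0 1 + X u1 0 1) / 2.
have qE v : sg * sol_s (X v) = m0 ->
    2 * hdist2 a b (X v) + Q z u1 / 2 = Q v u1 + Q v z.
  move=> /sE sv; rewrite /hdist2 sv /Q /hnorm2 /a /b; field.
  by rewrite gt_eqF ?expR_gt0.
have qz : 4 * hdist2 a b (X z) = Q z u1.
  have Qzz : Q z z = 0 by rewrite /Q /hnorm2 !subrr mulr0 mul0r expr0n addr0.
  by have := qE z zZ; rewrite Qzz; clear; lra.
apply: False_ind; apply: (@no_touching_disc R sg m0 a b (r - `|z - u0|) U X z) => //.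
- by rewrite subr_gt0.
- move=> v vz; apply: rU.
  by have := ler_distD z v u0; move: vz; clear; lra.
- by clear -qz zu1; lra.
- move=> v vz vZ vneq.
  have vr : `|v - u0| <= r.
    by have := ler_distD z v u0; move: vz; clear; lra.
  have h1 : Q z u1 <= Q v u1 by apply: zmin.
  have h2 := Qpos v z vr zr vneq.
  have h3 := qE v vZ; clear -h1 h2 h3 qz; lra.
Qed.

(** The horizontal derivatives of X span the plane, so both horizontal components
    of the displacement vanish. *)
Lemma critical_hdist2 (R : realType) (U : set 'rV[R]_2) (X : 'rV[R]_2 -> 'rV[R]_3)
    (u : 'rV[R]_2) (a b : R) :
  minimal_on U X -> U u ->
  (forall i, partial i X u 0 ord_max = 0) ->
  (\forall v \near u, hdist2 a b (X u) <= hdist2 a b (X v)) ->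
  X u 0 0 = a /\ X u 0 1 = b.
Proof.
move=> [Uo sX injX _] Uu crit umin.
have FF : Filter (nbhs u) := nbhs_filter u.
have nU : nbhs u U by exact: open_nbhs_nbhs.
have dX := smooth_differentiable sX Uu.
have det := horizontal_det_neq0 (immersion_free dX (injX _ Uu)) (crit 0) (crit 1).
have E0 : expR (sol_s (X u)) != 0 by rewrite gt_eqF ?expR_gt0.
have crit_eq i : expR (sol_s (X u)) ^+ 2 * (X u 0 0 - a) * partial i X u 0 0 +
    expR (sol_s (X u)) ^- 2 * (X u 0 1 - b) * partial i X u 0 1 = 0.
  pose v : 'rV[R]_2 := delta_mx 0 i.
  have [r r0 rP] := near_line v (filterI nU umin).
  have d k (t : R) : `|t| < r -> der t (fun t => X (u + t *: v) 0 k) (line_velocity X u v k t).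
    by move=> /rP[Ut _]; exact: (der_line sX).
  have hm (t : R) : `|t| < r -> hdist2 a b (X (u + 0 *: v)) <= hdist2 a b (X (u + t *: v)).
    by move=> /rP[_ /=]; rewrite scale0r addr0.
  have := first_derivative_test r0
    (fun t tr => der_hnorm2 (der_shift a (d 0 t tr)) (der_shift b (d 1 t tr)) (d ord_max t tr)) hm.
  rewrite !line_velocity_delta crit scale0r addr0 /dhnorm2 -/(sol_s (X u)) => e.
  rewrite -[RHS](mulr0 (2^-1)) -e.
  by move: (X u 0 0) (X u 0 1) (partial i X u 0 0) (partial i X u 0 1) (expR _) E0
     => ? ? ? ? ? ?; field.
have det' : partial 0 X u 0 0 * partial 1 X u 0 1
    - partial 0 X u 0 1 * partial 1 X u 0 0 != 0.
  by rewrite [partial 0 X u 0 1 * _]mulrC.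
have [/eqP + /eqP] := det2_ker0 det' (crit_eq 0) (crit_eq 1).
rewrite !mulf_eq0 invr_eq0 !expf_eq0 (negbTE E0) /= !subr_eq0.
by move=> /eqP -> /eqP ->.
Qed.

(** * From charts to the surface *)

Section Charts.
Variables (R : realType) (M : surface R) (f : M -> 'rV[R]_3).
Hypothesis fmin : minimal_immersion (@sol_metric R) f.

Lemma chart_minimal_on c : atlas c -> minimal_on (chart_img c) (f \o chart_inv c).
Proof.
move=> ac; have [[[_ sm] im] mc] := fmin.
split; [exact: chart_img_open|exact: sm|exact: im|exact: mc].
Qed.

(** The parametrization is continuous within the image of the chart, which is
    open. *)
Lemma near_chart_inv (c : chart R M) (x : M) (P : set M) : chart_dom c x ->
  nbhs x P -> \forall v \near chart_map c x, P (chart_inv c v).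
Proof.
move=> cx nP.
have ix : chart_img c (chart_map c x) by exists x.
have := @chart_inv_cont R M c; rewrite -/(chart_img c).
rewrite continuous_open_subspace; last exact: chart_img_open.
move=> /(_ _ (mem_set ix)) ci.
by apply: ci; rewrite chart_mapK.
Qed.

Lemma near_chart_map (c : chart R M) (x : M) (P : set 'rV[R]_2) : chart_dom c x ->
  nbhs (chart_map c x) P -> \forall y \near x, chart_dom c y /\ P (chart_map c y).
Proof.
move=> cx nP.
have := @chart_map_cont R M c.
rewrite continuous_open_subspace; last exact: chart_dom_open.
move=> /(_ _ (mem_set cx)) /(_ _ nP) nx.
have nd : nbhs x (chart_dom c) by apply: open_nbhs_nbhs; split => //; exact: chart_dom_open.
exact: filterI nd nx.
Qed.

Lemma surface_no_barrier_min (sg eta a b : R) (x : M) :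
  0 < hdist2 a b (f x) -> sg ^+ 2 = 1 -> 0 < eta ->
  eta * (4 + 2 / hdist2 a b (f x)) < 2 * expR (- 2 * sg * sol_s (f x)) ->
  ~ \forall y \near x, barrier sg eta a b (f x) <= barrier sg eta a b (f y).
Proof.
move=> q0 sg2 e0 small xmin.
have [c ac cx] := atlas_cover x.
have [Uo sX injX minX] := chart_minimal_on ac.
have ix : chart_img c (chart_map c x) by exists x.
have fx : (f \o chart_inv c) (chart_map c x) = f x by rewrite /= chart_mapK.
apply: (@no_interior_min R sg eta a b _ _ _ Uo sX ix (injX _ ix) (minX _ ix));
  rewrite ?fx//.
exact: near_chart_inv cx xmin.
Qed.

Lemma surface_contact_open (sg m0 : R) (x : M) : sg ^+ 2 = 1 ->
  (forall y, m0 <= sg * sol_s (f y)) -> sg * sol_s (f x) = m0 ->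
  \forall y \near x, sg * sol_s (f y) = m0.
Proof.
move=> sg2 wm wx.
have [c ac cx] := atlas_cover x.
have ix : chart_img c (chart_map c x) by exists x.
have fx : (f \o chart_inv c) (chart_map c x) = f x by rewrite /= chart_mapK.
have n : \forall v \near chart_map c x, sg * sol_s ((f \o chart_inv c) v) = m0.
  apply: (contact_set_open (chart_minimal_on ac) sg2 _ ix); last by rewrite fx.
  by move=> v _; exact: wm.
have := near_chart_map cx n; apply: filterS => y /= [cy].
by rewrite chart_mapK.
Qed.

Lemma surface_nearest_point (sg m0 a b : R) (x : M) : sg ^+ 2 = 1 ->
  (forall y, sg * sol_s (f y) = m0) ->
  (forall y, hdist2 a b (f x) <= hdist2 a b (f y)) ->
  f x 0 0 = a /\ f x 0 1 = b.
Proof.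
move=> sg2 wm xmin.
have [c ac cx] := atlas_cover x.
have ix : chart_img c (chart_map c x) by exists x.
have fx : (f \o chart_inv c) (chart_map c x) = f x by rewrite /= chart_mapK.
have mX := chart_minimal_on ac; have [Uo sX _ _] := mX.
have n : \forall v \near chart_map c x,
    hdist2 a b ((f \o chart_inv c) (chart_map c x)) <= hdist2 a b ((f \o chart_inv c) v).
  by apply: filterE => v; rewrite fx; exact: xmin.
rewrite -fx; apply: (critical_hdist2 mX ix) => //.
apply: (critical_height sg2 Uo sX ix).
by apply: filterE => v; rewrite /= !wm.
Qed.

End Charts.

(** * The half-space theorem *)

(** The height is bounded on the slab, so the squared horizontal distance
    [hdist2] is comparable to the Euclidean one. *)
Lemma compact_slab (R : realType) (sg m0 a b B : R) : sg ^+ 2 = 1 ->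
  compact [set p : 'rV[R]_3 |
    [/\ m0 <= sg * sol_s p, sg * sol_s p <= m0 + 1 & hdist2 a b p <= B]].
Proof.
move=> sg2.
have sg1 : `|sg| = 1 by apply/eqP; rewrite -sqrp_eq1// -normrX sg2 normr1.
apply: bounded_closed_compact.
  pose C := `|m0| + 1; pose D := expR C * (B + 1).
  exists (C + D + `|a| + `|b|); split; first exact: num_real.
  move=> N ND p /= [h1 h2 h3].
  have sC : `|sol_s p| <= C.
    rewrite -[leLHS]mul1r -sg1 -normrM ler_norml /C.
    by have := ler_norm m0; have := ler_norm (- m0); rewrite normrN; lra.
  have B0 : 0 <= B by apply: le_trans h3; exact: hnorm2_ge0.
  have sq (z : R) : z ^+ 2 <= B -> `|z| <= B + 1.
    by move=> zB; rewrite ler_norml; apply/andP; split; nra.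
  have [xB yB] : (expR (sol_s p) * (p 0 0 - a)) ^+ 2 <= B /\
      ((p 0 1 - b) / expR (sol_s p)) ^+ 2 <= B.
    move: h3; rewrite /hdist2 /hnorm2.
    by have := sqr_ge0 (expR (sol_s p) * (p 0 0 - a));
      have := sqr_ge0 ((p 0 1 - b) / expR (sol_s p)); lra.
  have Ep := expR_gt0 (sol_s p).
  have B1 : 0 <= B + 1 by lra.
  have [Cl Cu] : - C <= sol_s p /\ sol_s p <= C by apply/andP; rewrite -ler_norml.
  have x1 : `|p 0 0 - a| <= D.
    have := sq _ xB; rewrite normrM gtr0_norm// mulrC -ler_pdivlMr// => h.
    apply: le_trans h _; rewrite /D mulrC -expRN.
    by rewrite ler_wpM2r// ler_expR; lra.
  have y1 : `|p 0 1 - b| <= D.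
    have := sq _ yB; rewrite normrM normfV (gtr0_norm Ep) ler_pdivrMr// => h.
    apply: le_trans h _; rewrite /D mulrC.
    by rewrite ler_wpM2r// ler_expR.
  have C0 : 0 <= C by rewrite addr_ge0.
  have D0 : 0 <= D by rewrite mulr_ge0// expR_ge0.
  have a0 := normr_ge0 a; have b0 := normr_ge0 b.
  have xD : `|p 0 0| <= D + `|a|.
    by rewrite -(subrK a (p 0 0)) (le_trans (ler_normD _ _))// lerD2r.
  have yD : `|p 0 1| <= D + `|b|.
    by rewrite -(subrK b (p 0 1)) (le_trans (ler_normD _ _))// lerD2r.
  have N0 : 0 <= N by lra.
  have k0 : `|p 0 0| <= N by lra.
  have k1 : `|p 0 1| <= N by lra.
  have k2 : `|p 0 ord_max| <= N by move: sC; rewrite /sol_s; lra.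
  rewrite /Num.norm /= mx_normrE; apply: bigmax_le; first exact: N0.
  move=> [i k] _ /=; rewrite (ord1 i).
  by have [->|->|->] := ord3P k.
have cw := @continuous_height R sg.
have -> : [set p : 'rV[R]_3 |
    [/\ m0 <= sg * sol_s p, sg * sol_s p <= m0 + 1 & hdist2 a b p <= B]] =
  [set p | m0 <= sg * sol_s p] `&` [set p | sg * sol_s p <= m0 + 1] `&`
  [set p | hdist2 a b p <= B].
  by apply/seteqP; split => p /= [] => [h1 h2 h3|[h1 h2] h3].
apply: closedI; first apply: closedI.
- exact: (closed_comp (fun p _ => cw p) (@closed_ge R m0)).
- exact: (closed_comp (fun p _ => cw p) (@closed_le R (m0 + 1))).
- exact: (closed_comp (fun p _ => @continuous_hdist2 R a b p) (@closed_le R B)).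
Qed.

(** If the infimum were not attained, the barriers centred at the origin would
    have an interior minimum on the surface. *)
Lemma lower_bound_attained (R : realType) (M : surface R) (f : M -> 'rV[R]_3) (sg c0 : R) :
  [set: M] !=set0 -> minimal_immersion (@sol_metric R) f -> proper_map f -> sg ^+ 2 = 1 ->
  (forall x, c0 <= sg * sol_s (f x)) ->
  exists x, forall y, sg * sol_s (f x) <= sg * sol_s (f y).
Proof.
move=> [x0 _] fmin [fc fp] sg2 wc.
pose w x := sg * sol_s (f x).
have cw : continuous w.
  by move=> x; exact: (cvg_comp _ _ (fc x) (@continuous_height R sg (f x))).
have cq : continuous (fun x => hdist2 0 0 (f x)).
  by move=> x; apply: cvg_comp; [exact: fc|exact: continuous_hdist2].
pose m0 := inf (range w).
have hinf : has_inf (range w).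
  by split; [exists (w x0), x0|exists c0 => _ [x _ <-]; exact: wc].
have wm x : m0 <= w x by apply: ge_inf; [by case: hinf|exists x].
have [//|no] := pselect (exists x, w x = m0); first by move=> [x wx]; exists x => y; rewrite -!/(w _) wx.
have wlt x : m0 < w x.
  by rewrite lt_def wm andbT; apply/eqP => e; apply: no; exists x.
pose K B := f @^-1` [set p : 'rV[R]_3 |
    [/\ m0 <= sg * sol_s p, sg * sol_s p <= m0 + 1 & hdist2 0 0 p <= B]].
have cK B : compact (K B) by apply: fp; exact: compact_slab.
have [d0 d00 d0P] : exists2 d, 0 < d & forall x, K 1 x -> d <= w x - m0.
  apply: compact_pos_lb; first exact: cK.
    by move=> x _; exact: (cvgB (cw x) (cvg_cst _)).
  by move=> x _; rewrite subr_gt0.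
pose d := Num.min (d0 / 2) 1.
have [d_gt0 dd0 d1] : [/\ 0 < d, d < d0 & d <= 1].
  have h1 : d <= d0 / 2 by rewrite ge_min lexx.
  have h2 : d <= 1 by rewrite ge_min lexx orbT.
  by split => //; [rewrite lt_min ltr01 divr_gt0|lra].
(* Below height m0 + d the surface stays over the region q > 1. *)
have qgt x : w x <= m0 + d -> 1 < hdist2 0 0 (f x).
  move=> wx; rewrite ltNge; apply/negP => q1.
  have : K 1 x by split => //; [exact: wm|rewrite -/(w x); lra].
  by move=> /d0P; lra.
have [p wp] : exists p, w p < m0 + d.
  have [_ [p _ <-] wp] := inf_adherent d_gt0 hinf; by exists p.
have qp : 1 < hdist2 0 0 (f p) by apply: qgt; exact: ltW.
have lnp : 0 < ln (hdist2 0 0 (f p)) by rewrite ln_gt0.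
have expE (u v : R) : u < v -> expR (- 2 * v) < expR (- 2 * u).
  by move=> uv; rewrite ltr_expR ltr_nM2l//; lra.
(* The first bound on eta is for the touching principle, where q > 1; the
   second one puts F p below every value of F at height m0 + d. *)
have [eta [e0 esmall1 esmall2]] : exists e, [/\ 0 < e, e < expR (- 2 * (m0 + 1)) / 3 &
    e * ln (hdist2 0 0 (f p)) < expR (- 2 * w p) - expR (- 2 * (m0 + d))].
  by apply: exists_small_factor => //; rewrite ?divr_gt0 ?expR_gt0// subr_gt0 expE.
pose G x := barrier sg eta 0 0 (f x).
have GE x : G x = - expR (- 2 * w x) + eta * ln (hdist2 0 0 (f x)).
  by rewrite /G /barrier /profile -/(hdist2 0 0 (f x)) -!mulrA.
have Gp : G p < - expR (- 2 * (m0 + d)) by rewrite GE; lra.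
(* G y <= G p bounds ln q, which confines y to a compact set. *)
pose B := expR (expR (- 2 * m0) / eta).
pose KB := K B `&` [set x | w x <= m0 + d].
have cKB : compact KB.
  apply: compact_closedI; first exact: cK.
  exact: (closed_comp (fun x _ => cw x) (@closed_le R (m0 + d))).
have inKB x : w x <= m0 + d -> G x <= G p -> KB x.
  move=> wx Gx; split => //; split; [exact: wm|rewrite -/(w x); lra|].
  have q1 := qgt x wx.
  have q0 : 0 < hdist2 0 0 (f x) by lra.
  rewrite -(lnK q0) ler_expR ler_pdivlMr// mulrC.
  have h1 : expR (- 2 * w x) < expR (- 2 * m0) by exact: expE.
  have h2 := expR_gt0 (- 2 * (m0 + d)).
  by move: Gx; rewrite GE; lra.
have [x [_ /= xd] xmin] : exists2 x, KB x & forall y, KB y -> G x <= G y.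
  apply: compact_min => //.
    by exists p; apply: inKB => //; exact: ltW.
  move=> y [_ /= yd]; apply: cvg_comp; first exact: fc.
  by apply: continuous_barrier; have := qgt y yd; lra.
have xmin' y : w y <= m0 + d -> G x <= G y.
  move=> yd; have [yp|py] := leP (G y) (G p); first by apply: xmin; exact: inKB.
  apply: le_trans (ltW py); apply: xmin; apply: inKB => //; exact: ltW.
have q1 := qgt x xd.
have xlt : w x < m0 + d.
  rewrite lt_def xd andbT; apply/eqP => e.
  have : G x <= G p by apply: xmin'; exact: ltW.
  rewrite GE -e; have : 0 < eta * ln (hdist2 0 0 (f x)) by rewrite mulr_gt0// ln_gt0.
  by move: Gp; rewrite e; lra.
exfalso; apply: (@surface_no_barrier_min R M f fmin sg eta 0 0 x) => //.
- by lra.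
- have h : 2 / hdist2 0 0 (f x) <= 2 by rewrite ler_pdivrMr; lra.
  have h2 : eta * (4 + 2 / hdist2 0 0 (f x)) <= eta * 6 by rewrite ler_pM2l//; lra.
  have h3 : expR (- 2 * (m0 + 1)) < expR (- 2 * sg * sol_s (f x)).
    by rewrite -mulrA; apply: expE; rewrite -/(w x); lra.
  lra.
- have n : \forall y \near x, w y < m0 + d by apply: (cvgr_lt _ (cw x)).
  by apply: filterS n => y yd; apply: xmin'; exact: ltW.
Qed.

(** Both one-sided situations at once: sg = 1 for a surface above a special
    plane and sg = -1 for a surface below one. *)
Lemma bounded_below_is_plane (R : realType) (M : surface R) (f : M -> 'rV[R]_3) (sg c0 : R) :
  [set: M] !=set0 -> connected [set: M] ->
  minimal_immersion (@sol_metric R) f -> proper_map f -> sg ^+ 2 = 1 ->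
  (forall x, c0 <= sg * sol_s (f x)) ->
  exists u, range f = special_plane u.
Proof.
move=> M0 Mc fmin fprop sg2 wc; have [fc fp] := fprop.
have [x0 x0min] := lower_bound_attained M0 fmin fprop sg2 wc.
pose m0 := sg * sol_s (f x0).
pose w x := sg * sol_s (f x).
have cw : continuous w.
  by move=> x; exact: (cvg_comp _ _ (fc x) (@continuous_height R sg (f x))).
have wT : [set x | w x = m0] = [set: M].
  apply: Mc; first by exists x0.
    exists [set x | w x = m0]; last by rewrite setTI.
    by rewrite openE => x /= wx; exact: (surface_contact_open fmin sg2 x0min wx).
  exists [set x | w x = m0]; last by rewrite setTI.
  exact: (closed_comp (fun x _ => cw x) (@closed_eq R m0)).
have wE x : sg * sol_s (f x) = m0 by have : [set: M] x by []; rewrite -wT.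
have sE x : sol_s (f x) = sg * m0.
  by rewrite -(wE x) mulrA -expr2 sg2 mul1r.
exists (sg * m0); apply/seteqP; split => [_ [x _ <-]|p /= ps]; first exact: sE.
(* The point of the surface whose horizontal distance to p is least. *)
pose a := p 0 0; pose b := p 0 1.
pose K := f @^-1` [set p : 'rV[R]_3 | [/\ m0 <= sg * sol_s p, sg * sol_s p <= m0 + 1 &
   hdist2 a b p <= hdist2 a b (f x0)]].
have cK : compact K by apply: fp; exact: compact_slab.
have inK x : hdist2 a b (f x) <= hdist2 a b (f x0) -> K x.
  by move=> h; split; rewrite ?wE ?lerDl.
have [x _ xmin] : exists2 x, K x & forall y, K y -> hdist2 a b (f x) <= hdist2 a b (f y).
  apply: compact_min => //; first by exists x0; exact: inK.
  by move=> y _; apply: cvg_comp; [exact: fc|exact: continuous_hdist2].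
have xmin' y : hdist2 a b (f x) <= hdist2 a b (f y).
  have [yx|xy] := leP (hdist2 a b (f y)) (hdist2 a b (f x0)).
    by apply: xmin; exact: inK.
  by apply: le_trans (ltW xy); apply: xmin; exact: inK.
have [xa xb] := surface_nearest_point fmin sg2 wE xmin'.
exists x => //; apply/rowP => k.
have [->|->|->] := ord3P k => //.
by have := sE x; rewrite -ps.
Qed.

Theorem theorem1p5 (R : realType) (S : set 'rV[R]_3)
    (hS : properly_immersed_minimal_surface (@sol_metric R) S)
    (t : R) (ht : on_one_side S t) :
  exists u : R, S = special_plane u.
Proof.
have [M [f [M0 Mc fmin fprop SE]]] := hS; rewrite SE.
have [above|below] := ht.
- apply: (@bounded_below_is_plane R M f 1 t) => //; first by rewrite expr1n.
  by move=> x; rewrite mul1r; apply: above; rewrite SE; exists x.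
- apply: (@bounded_below_is_plane R M f (-1) (- t)) => //; first by rewrite sqrrN expr1n.
  by move=> x; rewrite mulN1r lerN2; apply: below; rewrite SE; exists x.
Qed.
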